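(* Let $G$ be a finite loopless multigraph on $n$ vertices with maximum degree $\Delta$, and let $L\colon E(G)\to 2^{\mathbb{N}}$ be a list assignment on the edges of $G$. For $x\in V(G)$ put $f(x,L)\coloneqq\bigcap_{e\in E_G(x)}L(e)$. \begin{enumerate} \item If $|f(x,L)|\ge \deg(x)+\lfloor \deg(x)/2\rfloor$ for each $x\in V(G)$, then $G$ has a proper $L$-edge-coloring. \item If $|f(x,L)|\ge \deg(x)+\mu(x)$ for each $x\in V(G)$, then $G$ has a proper $L$-edge-coloring. \item If $G$ is bipartite and $|f(x,L)|\ge \deg(x)$ for each $x\in V(G)$, then $G$ has a proper $L$-edge-coloring. \end{enumerate} Moreover, if $|f(x,L)|\le \mathrm{poly}(\Delta,n)$ for each $x$, there is a $\mathrm{poly}(\Delta,n)$-time algorithm computing such colorings.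
   Context: $E_G(x)$ is the set of edges incident to $x$, $\deg(x)=|E_G(x)|$, $\mu(x,z)$ is the number of edges between $x$ and $z$, and $\mu(x)\coloneqq\max_z\mu(x,z)$. A proper $L$-edge-coloring is a map $\phi\colon E(G)\to\mathbb{N}$ with $\phi(e)\in L(e)$ for every edge $e$ and $\phi(e)\ne\phi(e')$ whenever the distinct edges $e,e'$ share an endpoint. *)

(* Defs.v *)
From mathcomp Require Import all_boot all_order all_algebra.
From mathcomp Require Import all_classical.

Set Implicit Arguments.
Unset Strict Implicit.
Unset Printing Implicit Defensive.

Local Open Scope nat_scope.

(** * Finite loopless multigraphs *)

(* Parallel edges are distinct elements of [edge] with the same [ends]. *)
Record multigraph := Multigraph {
  vert : finType;
  edge : finType;
  ends : edge -> {set vert};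
  endsP : forall e, #|ends e| = 2
}.

Section Graph.
Variable G : multigraph.
Implicit Types (x z : vert G) (e : edge G).

Definition order : nat := #|vert G|.

Definition incident x : {set edge G} := [set e | x \in ends e]%SET.

Definition deg x : nat := #|incident x|.

Definition maxdeg : nat := \max_(x : vert G) deg x.

Definition mu x z : nat := #|[set e | ends e == [set x; z]]%SET|.

Definition maxmu x : nat := \max_(z : vert G) mu x z.

Definition bipartite : Prop :=
  exists side : vert G -> bool,
    forall e x z, x \in ends e -> z \in ends e -> x != z -> side x != side z.

Definition list_assignment := edge G -> set nat.

(* For an isolated vertex the intersection is empty-indexed, hence all of
   [nat]. *)
Definition common_colors (L : list_assignment) x : set nat :=
  (\bigcap_(e in [set` incident x]) L e)%classic.

(* |A| >= k for a possibly infinite set A, and |A| <= k. *)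
Definition card_ge (A : set nat) (k : nat) : Prop := (`I_k #<= A)%card.
Definition card_le_nat (A : set nat) (k : nat) : Prop := (A #<= `I_k)%card.

Definition proper_list_coloring (L : list_assignment) (phi : edge G -> nat)
    : Prop :=
  (forall e, L e (phi e)) /\
  (forall e e', e != e' -> (exists x, x \in ends e /\ x \in ends e') ->
     phi e <> phi e').

Definition shannon_lists (L : list_assignment) : Prop :=
  forall x, card_ge (common_colors L x) (deg x + (deg x)./2).

Definition vizing_lists (L : list_assignment) : Prop :=
  forall x, card_ge (common_colors L x) (deg x + maxmu x).

Definition konig_lists (L : list_assignment) : Prop :=
  bipartite /\ forall x, card_ge (common_colors L x) (deg x).

End Graph.

(** * Random access machines

    Structured programs for the unit-cost random access machine with addition
    and truncated subtraction, but no multiplication: with these instructions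
    unit cost agrees with Turing-machine time up to a polynomial.  The memory
    is a family of arrays of natural numbers with indirect addressing inside
    each array.  The array name occurs as a literal in the program, so a
    program uses finitely many arrays, which could be interleaved in one. *)

Inductive expr : Type :=
| Const of nat
| Get of nat & expr          (* [Get a i] reads cell [i] of array [a] *)
| Add of expr & expr
| Sub of expr & expr.

Inductive prog : Type :=
| Skip
| Put of nat & expr & expr   (* [Put a i v] writes [v] to cell [i] of [a] *)
| Seq of prog & prog
| If of expr & prog & prog   (* a test succeeds when its value is nonzero *)
| While of expr & prog.

Definition store := nat -> nat -> nat.

Definition update (s : store) (a i v : nat) : store :=
  fun b j => if (b == a) && (j == i) then v else s b j.

Fixpoint eval (s : store) (u : expr) : nat :=
  match u with
  | Const k => k
  | Get a i => s a (eval s i)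
  | Add u1 u2 => eval s u1 + eval s u2
  | Sub u1 u2 => eval s u1 - eval s u2
  end.

Fixpoint cost (u : expr) : nat :=
  match u with
  | Const _ => 1
  | Get _ i => (cost i).+1
  | Add u1 u2 | Sub u1 u2 => (cost u1 + cost u2).+1
  end.

(* [exec c s t s']: started in [s], [c] halts in [s'] after exactly [t]
   elementary steps. *)
Inductive exec : prog -> store -> nat -> store -> Prop :=
| exec_skip s : exec Skip s 1 s
| exec_put s a i v :
    exec (Put a i v) s (cost i + cost v).+1 (update s a (eval s i) (eval s v))
| exec_seq c1 c2 s t1 s1 t2 s2 :
    exec c1 s t1 s1 -> exec c2 s1 t2 s2 -> exec (Seq c1 c2) s (t1 + t2) s2
| exec_if_true u c1 c2 s t s' :
    eval s u != 0 -> exec c1 s t s' ->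
    exec (If u c1 c2) s ((cost u).+1 + t) s'
| exec_if_false u c1 c2 s t s' :
    eval s u = 0 -> exec c2 s t s' ->
    exec (If u c1 c2) s ((cost u).+1 + t) s'
| exec_while_false u c s :
    eval s u = 0 -> exec (While u c) s (cost u).+1 s
| exec_while_true u c s t1 s1 t2 s2 :
    eval s u != 0 -> exec c s t1 s1 -> exec (While u c) s1 t2 s2 ->
    exec (While u c) s ((cost u).+1 + t1 + t2) s2.

(** * Edge coloring as a computational problem *)

Section Encoding.
Variable G : multigraph.

(* Vertices and edges are numbered from 0 in the order of [enum]. *)
Definition endpoint_numbers (e : edge G) : seq nat :=
  [seq nat_of_ord (enum_rank x) | x <- enum (ends e)].

(* [F] lists the sets f(x, L).  An isolated vertex, for which f(x, L) is
   infinite and no edge depends on it, gets the empty list. *)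
Definition lists_common_colors (L : list_assignment G)
    (F : vert G -> seq nat) : Prop :=
  forall x, if deg x == 0 then F x = [::]
            else uniq (F x) /\ forall c, c \in F x <-> common_colors L x c.

(* Array 0: number of vertices, number of edges.
   Arrays 1 and 2: first and second endpoint of each edge.
   Arrays 3 and 4: array 4 is the concatenation of the lists F(x), and the
   list of vertex number i occupies the cells from [s 3 i] (included) to
   [s 3 i.+1] (excluded). *)
Definition input (F : vert G -> seq nat) : store :=
  let Fs := [seq F x | x <- enum (vert G)] in
  fun a i =>
    match a with
    | 0 => nth 0 [:: #|vert G|; #|edge G|] i
    | 1 => nth 0 [seq nth 0 (endpoint_numbers e) 0 | e <- enum (edge G)] i
    | 2 => nth 0 [seq nth 0 (endpoint_numbers e) 1 | e <- enum (edge G)] i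
    | 3 => sumn (take i (map size Fs))
    | 4 => nth 0 (flatten Fs) i
    | _ => 0
    end.

(* The color of edge number j is left in cell j of array 5. *)
Definition output (s : store) (e : edge G) : nat := s 5 (enum_rank e).

End Encoding.

Definition eval2 (p : {poly {poly nat}}) (d n : nat) : nat :=
  (p.[n%:P].[d])%R.

(* For each polynomial bound [p] on the sizes of the sets f(x, L), there are a
   single program and a polynomial [q] such that, on every instance satisfying
   [P], the program computes a proper L-edge-coloring within q(Delta, n)
   steps. *)
Definition poly_time_colorable
    (P : forall G : multigraph, list_assignment G -> Prop) : Prop :=
  forall p : {poly {poly nat}},
  exists (c : prog) (q : {poly {poly nat}}),
  forall (G : multigraph) (L : list_assignment G) (F : vert G -> seq nat),
    P G L ->
    (forall x, 0 < deg x ->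
       card_le_nat (common_colors L x) (eval2 p (maxdeg G) (order G))) ->
    lists_common_colors L F ->
    exists (t : nat) (s : store),
      [/\ exec c (input F) t s,
          t <= eval2 q (maxdeg G) (order G) &
          proper_list_coloring L (@output G s)].

(* Main.v *)
Require Import Defs.
From mathcomp Require Import all_boot all_order all_algebra.
From mathcomp Require Import all_classical.
From mathcomp Require Import zify.

(** Replace L(e) by the union of f(u) and f(v) for e = uv.  Call an incidence (v, e) of a
    coloured edge good if the colour of e lies in f(v), and let Phi be the number
    of good incidences of a partial colouring, at most twice the number of edges.
    If e = pq is uncoloured and c in f(p) is missing at p, give e the colour c and
    uncolour the edge g = qr that had it, if there is one.  Then e gains a good
    incidence at p, the situation at q is unchanged and g loses one at r only if
    c lies in f(r).  So Phi never decreases, and it increases unless g exists and c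
    now is a missing colour in f(r).  A two-coloured walk of such steps that never
    increases Phi therefore has both colours in the lists of all its vertices,
    like a classical Kempe chain, and likewise for shifting a Vizing fan.

    If no walk started from a fan at x increases Phi, the fan behaves as in
    Vizing's theorem: its vertices have disjoint sets of missing colours, all of
    which occur at x on edges to the fan, while each colour missing at x occurs at
    every fan vertex.  Counting contradicts the Vizing bound, and also the Shannon
    bound if x is the end of smaller degree of the uncoloured edge; in a
    bipartite graph already the first walk contradicts parity.

    Hence at most 2|E| improvements, each found by trying all uncoloured edges,
    fan vertices and pairs of colours, complete the colouring; the program does
    exactly this, and existence follows by running it on finite sublists. *)

Set Implicit Arguments.
Unset Strict Implicit.
Unset Printing Implicit Defensive.

Local Open Scope nat_scope.

(** * Edge-coloured graphs on numbered vertices and edges *)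

(** Here [x] is the fan centre, [0] the first fan vertex and [k] a heavy one; [d], [e], [c], [F],
    [s] stand for degree, half degree, coloured degree, list size and number of missing colours, and
    [cm] for the coloured multiplicity between [x] and [k]. The bounds at [x] and [k] force
    [ek > ex]; those at [0] and [k], with [dx <= d0], force [ek < ex]. *)
Lemma shannon_arith (dx d0 dk cx c0 ck Fx F0 Fk sx s0 sk cm ex e0 ek : nat) :
  ex + ex <= dx < ex + ex + 2 -> e0 + e0 <= d0 < e0 + e0 + 2 -> ek + ek <= dk < ek + ek + 2 ->
  dx <= d0 -> dx + ex <= Fx -> d0 + e0 <= F0 -> dk + ek <= Fk ->
  Fx <= sx + cx -> F0 <= s0 + c0 -> Fk <= sk + ck -> cx < dx -> c0 < d0 -> ck <= dk ->
  sk + 1 <= cm -> s0 + sk <= cx -> sx + cm <= ck -> False.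
Proof. lia. Qed.

(** The list bound gives [s > mx] at a fan vertex with an uncoloured edge and [s >= mx] elsewhere,
    where [t = 1] supplies the missing unit. *)
Lemma vizing_arith (d c f s t cm mu mx : nat) :
  d + mx <= f -> f <= s + c -> s + t <= cm -> c < d \/ c <= d /\ t = 1 -> mu <= mx ->
  cm <= mu -> False.
Proof. lia. Qed.

Section CodedGraph.

Variables (n m : nat) (E1 E2 : nat -> nat) (F : nat -> seq nat).
Hypothesis E1n : forall i, i < m -> E1 i < n.
Hypothesis E2n : forall i, i < m -> E2 i < n.
Hypothesis E12 : forall i, i < m -> E1 i != E2 i.
Hypothesis F0 : forall v, 0 \notin F v.
Hypothesis Funiq : forall v, uniq (F v).

Definition inc i v := (E1 i == v) || (E2 i == v).
Definition oth i v := E1 i + E2 i - v.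

Lemma inc_oth i v : inc i v -> inc i (oth i v).
Proof. by rewrite /inc /oth => /orP[] /eqP <-; rewrite ?addKn ?addnK eqxx ?orbT. Qed.

Lemma othK i v : inc i v -> oth i (oth i v) = v.
Proof. rewrite /inc /oth; lia. Qed.

Lemma oth_neq i v : i < m -> inc i v -> oth i v != v.
Proof. move=> /E12; rewrite /inc /oth; lia. Qed.

Lemma inc_neq i v w : inc i v -> inc i w -> w != v -> w = oth i v.
Proof. rewrite /inc /oth; lia. Qed.

Lemma inc_ltn i v : i < m -> inc i v -> v < n.
Proof. by move=> im /orP[] /eqP <-; [apply: E1n|apply: E2n]. Qed.

Lemma incE i v : inc i v -> forall w, inc i w = (w == v) || (w == oth i v).
Proof. move=> iv w; move: iv; rewrite /inc /oth; lia. Qed.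

(** * Partial colourings, missing colours and the potential *)

Definition upd (T : nat -> nat) i c : nat -> nat := fun j => if j == i then c else T j.

Definition used (T : nat -> nat) v c := has (fun i => inc i v && (T i == c)) (iota 0 m).

Definition miss (T : nat -> nat) v := [seq c <- F v | ~~ used T v c].

(** Colour [0] means uncoloured; hence the exemption here and the exclusion of [0] from all lists by
    [F0]. *)
Definition proper (T : nat -> nat) := forall i j v,
  i < m -> j < m -> inc i v -> inc j v -> T i = T j -> T i != 0 -> i = j.

Definition allowed (T : nat -> nat) := forall i,
  i < m -> T i != 0 -> (T i \in F (E1 i)) || (T i \in F (E2 i)).

Definition okcol T := proper T /\ allowed T.

Definition gain i c : nat := (c \in F (E1 i)) + (c \in F (E2 i)).

Definition Phi (T : nat -> nat) := \sum_(i < m) gain i (T i).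

Lemma usedP T v c : reflect (exists i, [/\ i < m, inc i v & T i = c]) (used T v c).
Proof.
apply: (iffP hasP) => [[i] | [i [im iv Ti]]].
  by rewrite mem_iota add0n => /= im /andP[iv /eqP Ti]; exists i.
by exists i; rewrite ?mem_iota ?iv ?Ti ?eqxx.
Qed.

Lemma missP T v c : reflect (c \in F v /\ forall i, i < m -> inc i v -> T i != c) (c \in miss T v).
Proof.
rewrite mem_filter; apply: (iffP andP) => [[/usedP nu cF]|[cF nu]]; split=> //.
  by move=> i im iv; apply/eqP => Ti; apply: nu; exists i.
by apply/usedP => -[i [im iv /eqP]]; rewrite (negbTE (nu _ im iv)).
Qed.

Lemma eq_used T T' v c : (forall j, j < m -> T j = T' j) -> used T v c = used T' v c.
Proof. by move=> TT; apply/usedP/usedP => -[i [im iv Ti]]; exists i; rewrite ?TT// -TT. Qed.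

Lemma eq_miss T T' v : (forall j, j < m -> T j = T' j) -> miss T v = miss T' v.
Proof. by move=> TT; apply: eq_filter => c; rewrite (eq_used _ _ TT). Qed.

Lemma eq_Phi T T' : (forall j, j < m -> T j = T' j) -> Phi T = Phi T'.
Proof. by move=> TT; apply: eq_bigr => i _; rewrite TT. Qed.

Lemma eq_okcol T T' : (forall j, j < m -> T j = T' j) -> okcol T -> okcol T'.
Proof.
move=> TT [pT aT]; split=> [i j v im jm|i im]; rewrite -?TT //; [exact: pT|exact: aT].
Qed.

Lemma Phi_le T : Phi T <= m.*2.
Proof.
rewrite -muln2 -{1}[m]card_ord -sum_nat_const; apply: leq_sum => i _.
by rewrite /gain; do 2 case: (_ \in _).
Qed.

Lemma Phi_upd T i c : i < m -> Phi (upd T i c) + gain i (T i) = Phi T + gain i c.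
Proof.
move=> im; rewrite /Phi (bigD1 (Ordinal im)) //= [in RHS](bigD1 (Ordinal im)) //=.
rewrite {1}/upd eqxx addnAC [in RHS]addnAC [gain i c + _]addnC; congr (_ + _ + _).
apply: eq_bigr => j; rewrite -val_eqE /= /upd => ji; rewrite (negbTE ji) //.
Qed.

Lemma gain_oth i v c : inc i v -> gain i c = (c \in F v) + (c \in F (oth i v)).
Proof.
rewrite /gain /inc /oth => /orP[] /eqP <-; rewrite ?addKn ?addnK //; exact: addnC.
Qed.

Lemma gain0 i : gain i 0 = 0.
Proof. by rewrite /gain !(negbTE (F0 _)). Qed.

Lemma miss_neq0 T v c : c \in miss T v -> c != 0.
Proof. by move/missP => [cF _]; apply: contraNneq (F0 v) => <-. Qed.

Lemma color_proper T f p c :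
  proper T -> f < m -> inc f p -> c \in miss T p ->
  (forall i, i < m -> inc i (oth f p) -> T i != c) -> proper (upd T f c).
Proof.
move=> pT fm fp /missP[cF cp] cq.
have key i v : i < m -> inc i v -> inc f v -> i != f -> T i != c.
  move=> im iv; rewrite (incE fp) => /orP[] /eqP vE _; first by apply: cp; rewrite // -vE.
  by apply: cq; rewrite // -vE.
move=> i j v im jm iv jv; rewrite /upd.
case: (eqVneq i f) iv => [->|fi] iv; case: (eqVneq j f) jv => [->|fj] jv //.
- by move=> /esym cj _; move: (key j v jm jv iv fj); rewrite cj eqxx.
- by move=> ci _; move: (key i v im iv jv fi); rewrite ci eqxx.
- exact: pT im jm iv jv.
Qed.

Lemma color_free T f p c :
  okcol T -> f < m -> T f = 0 -> inc f p -> c \in miss T p ->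
  ~~ used T (oth f p) c -> okcol (upd T f c) /\ Phi T < Phi (upd T f c).
Proof.
move=> [pT aT] fm Tf fp cp cq; split; first split.
- apply: (@color_proper _ _ p) => // i im iq; apply: contra cq => /eqP Ti; apply/usedP; by exists i.
- move=> i im; rewrite /upd; case: (eqVneq i f) => [->|_]; last exact: (aT _ im).
  case/missP: cp => cF _ _; move: fp => /orP[] /eqP ->; by rewrite cF ?orbT.
- have := Phi_upd T c fm; rewrite Tf gain0 (gain_oth _ fp).
  case/missP: cp => -> _; lia.
Qed.

Lemma color_push T f p c g (q := oth f p) :
  okcol T -> f < m -> T f = 0 -> inc f p -> c \in miss T p ->
  g < m -> inc g q -> T g = c ->
  [/\ okcol (upd (upd T f c) g 0),
      Phi (upd (upd T f c) g 0) + (c \in F (oth g q)) = Phi T + 1 &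
      g != f /\ ~~ inc g p].
Proof.
move=> [pT aT] fm Tf fp cp gm gq Tg.
have c0 := miss_neq0 cp.
have gf : g != f by apply: contra_neq c0 => gf; rewrite -Tg gf.
have gp : ~~ inc g p by apply/negP => gp; case/missP: cp => _ /(_ g gm gp); rewrite Tg eqxx.
split => //; first split.
(* Uncolouring [g] first makes [c] free at both ends of [f], so that [color_proper] applies; the two
   updates commute because [g] differs from [f]. *)
- have pT' : proper (upd (upd T g 0) f c).
    apply: (@color_proper _ _ p) => //.
    + move=> i j v im jm iv jv; rewrite /upd; case: (eqVneq i g) => //; case: (eqVneq j g) => //.
        by move=> _ _ -> .
      by move=> _ _; apply: pT im jm iv jv.
    + apply/missP; case/missP: cp => cF cp; split=> // i im ip.
      rewrite /upd; case: (eqVneq i g) => [_|_]; [by rewrite eq_sym|exact: cp].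
    + move=> i im iq; rewrite /upd; case: (eqVneq i g) => [_|ig]; first by rewrite eq_sym.
      apply: contra_neq ig => Ti; apply: (pT i g q) => //; rewrite Ti ?Tg //.
  have -> // : upd (upd T f c) g 0 = upd (upd T g 0) f c.
  apply/funext => j; rewrite /upd; case: (eqVneq j g) => // ->; by rewrite (negbTE gf).
- move=> i im; rewrite /upd; case: (eqVneq i g) => // _.
  case: (eqVneq i f) => [->|_]; last exact: (aT _ im).
  case/missP: cp => cF _ _; move: fp => /orP[] /eqP ->; by rewrite cF ?orbT.
- have := Phi_upd (upd T f c) 0 gm; have := Phi_upd T c fm.
  have -> : upd T f c g = c by rewrite /upd (negbTE gf).
  rewrite Tf !gain0 (gain_oth _ fp) (gain_oth _ gq) -/q.
  case/missP: cp => -> _; lia.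
Qed.

(** * Two-coloured walks that keep the potential *)

(* In a configuration [(T, f, q, c, d)] the edge [f] is uncoloured in [T], the
   colour [c] is missing at the end of [f] other than [q], and [d] is missing
   at [q]. *)
Definition cfg : Type := (nat -> nat) * nat * nat * nat * nat.

Definition okcfg (k : cfg) := let: (T, f, q, c, d) := k in
  [/\ okcol T, f < m, T f = 0, inc f q & c \in miss T (oth f q) /\ d \in miss T q].

(** By [color_push], the condition on [oth g q] singles out the steps that leave [Phi] unchanged.
    The colours are swapped because [d], still missing at [q], is the next colour for [g], while [c]
    has become missing at [oth g q]. *)
Definition nstep (k k' : cfg) := let: (T, f, q, c, d) := k in
  exists g, [/\ g < m, inc g q, T g = c, c \in F (oth g q) &
                k' = (upd (upd T f c) g 0, g, oth g q, d, c)].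

Lemma nstep_ok k k' : okcfg k -> nstep k k' ->
  okcfg k' /\ Phi k'.1.1.1.1 = Phi k.1.1.1.1.
Proof.
case: k => [[[[T f] q] c] d] [oT fm Tf fq [cp dq]] [g [gm gq Tg cr ->]] /=.
have fp := inc_oth fq.
have [] := color_push oT fm Tf fp cp gm; rewrite ?othK //.
rewrite cr => oT' PT' [gf gp]; split; last lia.
have c0 := miss_neq0 cp; have [_ cpm] := missP _ _ _ cp.
split=> //; first by rewrite /upd eqxx.
  exact: inc_oth.
split; apply/missP.
  case/missP: dq => dF dq; split=> // i im iq; rewrite /upd.
  case: (eqVneq i g) => _; first by apply: contraNneq (F0 q) => ->.
  case: (eqVneq i f) => _; last exact: dq.
  by apply/eqP => cd; move: (dq g gm gq); rewrite Tg cd eqxx.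
split=> // i im ir; rewrite /upd; case: (eqVneq i g) => [_|ig]; first by rewrite eq_sym.
(* The edge [f] now has colour [c], but it does not meet [oth g q]: otherwise [g] would meet the
   other end of [f], where [c] was missing. *)
case: (eqVneq i f) ir => [->|_] ir.
  case/negP: gp; move: ir; rewrite (incE fq) => /orP[] /eqP rE.
    by have := oth_neq gm gq; rewrite rE eqxx.
  by rewrite -rE; apply: inc_oth.
apply: contra_neq ig => Ti; apply: (oT.1 i g (oth g q)) => //; first exact: inc_oth.
  by rewrite Ti.
by rewrite Ti.
Qed.

Inductive chain (k : cfg) : nat -> cfg -> Prop :=
| chain0 : chain k 0 k
| chainS j k1 k2 : chain k j k1 -> nstep k1 k2 -> chain k j.+1 k2.

Lemma chain_ok k j k' : okcfg k -> chain k j k' ->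
  okcfg k' /\ Phi k'.1.1.1.1 = Phi k.1.1.1.1.
Proof.
move=> ok; elim=> {j k'} [//|j k1 k2 _ [ok1 P1] st].
by have [ok2 P2] := nstep_ok ok1 st; split=> //; rewrite P2.
Qed.

(** * Alternating paths off a vertex *)

Definition link (T : nat -> nat) x c v w :=
  exists h, [/\ h < m, T h = c, inc h v, w = oth h v & ~~ inc h x].

(** These paths begin and end with colour [a]. Their odd length gives the parity contradiction in
    bipartite graphs, and avoiding [x] makes them insensitive to shifts of colours along a fan at
    [x]. *)
Inductive alt (T : nat -> nat) x a b : nat -> nat -> Prop :=
| alt1 v w : link T x a v w -> alt T x a b v w
| altS v w y z : link T x a v w -> link T x b w y -> alt T x a b y z -> alt T x a b v z.

Lemma link_sym T x c v w : link T x c v w -> link T x c w v.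
Proof.
by move=> [h [hm Th hv -> hx]]; exists h; split; rewrite ?othK //; apply: inc_oth.
Qed.

Lemma alt_rcons T x a b v w y z : alt T x a b v w -> link T x b w y -> link T x a y z ->
  alt T x a b v z.
Proof.
elim=> {v w} [v w avw bwy ayz|v w y' z' avw bwy' _ IH bz ay]; apply: altS; eauto.
exact: alt1.
Qed.

Lemma alt_sym T x a b v w : alt T x a b v w -> alt T x a b w v.
Proof.
elim=> {v w} [v w /link_sym h|v w y z /link_sym avw /link_sym bwy _ IH]; first exact: alt1.
exact: alt_rcons IH bwy avw.
Qed.

Lemma link_fun T x c v w w' : proper T -> c != 0 ->
  link T x c v w -> link T x c v w' -> w = w'.
Proof.
move=> pT c0 [h [hm Th hv -> hx]] [h' [hm' Th' hv' -> hx']].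
by rewrite (pT h h' v) // ?Th ?Th'.
Qed.

(** In a proper colouring each vertex has at most one continuation in each colour. A vertex without
    a [b]-link is where the path has to stop, so two paths from [v] cannot stop at different
    places. *)
Lemma alt_fun T x a b v w w' : proper T -> a != 0 -> b != 0 ->
  (forall y, ~ link T x b w y) -> (forall y, ~ link T x b w' y) ->
  alt T x a b v w -> alt T x a b v w' -> w = w'.
Proof.
move=> pT a0 b0 nw nw' avw; elim: avw w' nw nw' => {v w}.
  move=> v w avw w' nw nw' avw'; case: avw' nw' avw => {v w'} [v w' avw' _ avw|].
    exact: link_fun avw avw'.
  move=> v z y w' avz bzy _ _ avw.
  by case: (nw y); rewrite (link_fun pT a0 avw avz).
move=> v z y w avz bzy yw IH w' nw nw' avw'.
case: avw' nw' avz => {v w'} [v w' avw' nw' avz|].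
  by case: (nw' y); rewrite (link_fun pT a0 avw' avz).
move=> v z' y' w' avz' bzy' yw' nw' avz; apply: IH => //.
have zz := link_fun pT a0 avz avz'; rewrite zz in bzy.
by rewrite (link_fun pT b0 bzy bzy').
Qed.

Lemma alt_ext T T' x a b v w : (forall h, h < m -> ~~ inc h x -> T h = T' h) ->
  alt T x a b v w -> alt T' x a b v w.
Proof.
move=> TT; have lk c y z : link T x c y z -> link T' x c y z.
  by move=> [h [hm Th hv -> hx]]; exists h; split; rewrite -?TT.
elim=> {v w} [v w /lk h|v w y z /lk avw /lk bwy _ IH]; first exact: alt1.
exact: altS avw bwy IH.
Qed.

(** A repetition could be moved back along the unique predecessors until it gives [x0] a
    predecessor. *)
Lemma path_uniq (A : eqType) (D : rel A) x0 s :
  (forall y, ~~ D y x0) -> (forall y y' z, D y z -> D y' z -> y = y') ->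
  path D x0 s -> uniq (x0 :: s).
Proof.
move=> Dx0 Dinj /(pathP x0) ps.
have step j : j < size s -> D (nth x0 (x0 :: s) j) (nth x0 (x0 :: s) j.+1) by move=> /ps.
have key : forall i j, i < j -> j <= size s -> nth x0 (x0 :: s) i != nth x0 (x0 :: s) j.
  elim=> [|i IH] [|j] // ij js; apply/eqP => e; have d1 := step _ js.
    by rewrite -e in d1; move: (Dx0 (nth x0 (x0 :: s) j)); rewrite d1.
  have d2 := step i (ltn_trans (ij : i < j) js); rewrite e in d2.
  by move: (IH j ij (ltnW js)); rewrite (Dinj _ _ _ d2 d1) eqxx.
apply/(uniqP x0) => i j; rewrite !inE /= !ltnS => is' js e.
case: (ltngtP i j) => // [ij|ji].
  by move: (key i j ij js); rewrite e eqxx.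
by move: (key j i ji is'); rewrite e eqxx.
Qed.

(** A dart [(h, q)] is the edge [h] oriented towards its end [q]. The orientation is what makes
    predecessors unique: an unoriented edge can be entered from both sides. *)
Definition dart_step (T : nat -> nat) x a b (u v : nat * nat) : bool :=
  [&& u.1 < m, v.1 < m, inc u.1 u.2, inc v.1 u.2, v.2 == oth v.1 u.2,
      ~~ inc u.1 x, ~~ inc v.1 x, T u.1 \in [:: a; b], T v.1 \in [:: a; b] & T u.1 != T v.1].

Lemma dart_stepE T x a b h q g r : dart_step T x a b (h, q) (g, r) ->
  [/\ [/\ h < m, g < m, inc h q & inc g q], r = oth g q, ~~ inc h x /\ ~~ inc g x &
      [/\ T h \in [:: a; b], T g \in [:: a; b] & T h != T g]].
Proof. by case/and5P => /= hm gm hq gq /and5P[/eqP -> hx gx Th /andP[]]. Qed.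

Lemma dart_step_inj T x a b u u' v : proper T -> a != 0 -> b != 0 ->
  dart_step T x a b u v -> dart_step T x a b u' v -> u = u'.
Proof.
case: u u' v => [h q] [h' q'] [g r] pT a0 b0 /dart_stepE[[hm gm hq gq] -> _ [Th Tg hg]].
case/dart_stepE => -[hm' _ hq' gq'] rE _ [Th' _ hg'].
have qq : q = q' by rewrite -(othK gq) rE othK.
rewrite -qq in hq' *; congr (_, _); apply: (pT h h' q) => //.
  move: Th Th' Tg hg hg'; rewrite !inE.
  by do 3 (case/orP => /eqP ->) => //; rewrite ?eqxx.
by move: Th; rewrite !inE => /orP[] /eqP ->.
Qed.

(** The first step uncolours a [b]-edge [g] at [x]; from then on the walk follows the path of [T] in
    colours [a] and [b] that starts at [oth g x]. Off [x] it never repeats a dart, so a long walk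
    has to return to [x]. It can do so only through [f], which now has colour [b], and then the path
    has reached [oth f x]. *)
Lemma walk_stuck T f x b a N k :
  okcfg (T, f, x, b, a) -> chain (T, f, x, b, a) N k -> m * n + 2 < N ->
  exists g, [/\ g < m, inc g x, T g = b, b \in F (oth g x) &
                alt T x a b (oth g x) (oth f x)].
Proof.
move=> ok0 ch NN; have [[pT aT] fm Tf fx [bu ax]] := ok0.
have a0 := miss_neq0 ax; have b0 := miss_neq0 bu.
have [aFx nax] := missP _ _ _ ax.
pose G g := [/\ g < m, inc g x, T g = b & b \in F (oth g x)].
(* The situation [j.+2] steps after the start, before any return to [x]. An edge off [x] that has
   colour [a] or [b] now had one of them in [T]; at [x] only [g] can have colour [a] and only [f]
   colour [b]. The darts [p0 :: s] are the edges uncoloured since the second step. *)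
pose Inv g j (k : cfg) := let: (T', f', q, c, d) := k in
  [/\ okcfg k, [/\ f' < m, ~~ inc f' x, inc f' q & T f' = d],
      (c = b /\ d = a /\ alt T x a b (oth g x) q) \/
      (c = a /\ d = b /\ exists2 y, alt T x a b (oth g x) y & link T x b y q),
      (forall h, h < m -> inc h x -> (T' h = a -> h = g) /\ (T' h = b -> h = f)) /\
      (forall h, h < m -> ~~ inc h x -> T' h \in [:: a; b] -> T h \in [:: a; b]) &
      exists p0 s, [/\ size s = j, forall y, ~~ dart_step T x a b y p0,
        path (dart_step T x a b) p0 s, last p0 s = (f', q) &
        all (fun p => (p.1 < m) && (p.2 < n)) (p0 :: s)]].
have main : match N return Prop with
  | 0 => k = (T, f, x, b, a)
  | 1 => exists2 g, G g & k = (upd (upd T f b) g 0, g, oth g x, a, b)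
  | j.+2 => exists2 g, G g & alt T x a b (oth g x) (oth f x) \/ Inv g j k
  end.
  elim: ch {NN} => {N k} [//|[|[|j]] k1 k2 ch IH st].
  - by move: st; rewrite IH => -[g [gm gx Tg br ->]]; exists g.
  - case: IH st => g [gm gx Tg br] kE.
    have ok1 : okcfg k1 by case: (chain_ok ok0 ch).
    rewrite kE => -[h [hm hw T1h ar ->]].
    have ab : a != b by rewrite -Tg eq_sym nax.
    have ok2 : okcfg (upd (upd (upd (upd T f b) g 0) g a) h 0, h, oth h (oth g x), b, a).
      by case: (nstep_ok (k' := (upd (upd (upd (upd T f b) g 0) g a) h 0, h, oth h (oth g x), b, a)) ok1) => //; rewrite kE; exists h.
    have hg : h != g by apply: contra_neq a0 => e; rewrite -T1h e /upd eqxx.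
    have hf : h != f.
      apply: contra_neq ab => e; rewrite -T1h e /upd eqxx; case: eqP => // fg.
      by case/eqP: hg; rewrite e fg.
    have Th : T h = a by rewrite -T1h /upd (negbTE hg) (negbTE hf).
    have hx : ~~ inc h x by apply: contraL (eqxx a) => hx; rewrite -{1}Th nax.
    exists g => //; right; split => //=.
    - by split=> //; apply: inc_oth.
    - by left; split=> //; split=> //; apply: alt1; exists h.
    - split=> i im ix.
        rewrite /upd; case: (eqVneq i h) ix => [->|ih] ix; first by rewrite (negbTE hx) in ix.
        case: (eqVneq i g) => [->|ig]; first by split=> // e; case/eqP: ab.
        case: (eqVneq i f) => [->|jf]; first by split=> // e; case/eqP: ab.
        split=> Ti; first by case/eqP: (nax i im ix).
        by case/eqP: ig; apply: (pT i g x); rewrite ?Ti ?Tg.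
      rewrite /upd; case: (eqVneq i h) => [->|ih]; first by rewrite Th !inE eqxx.
      case: (eqVneq i g) ix => [->|ig]; first by rewrite gx.
      by case: (eqVneq i f) => [->|//]; rewrite fx.
    (* This dart has no predecessor: that would be a [b]-edge off [x] at [oth g x], but the [b]-edge
       there is [g]. *)
    - exists (h, oth h (oth g x)), [::]; split=> //=.
        move=> [i q]; apply/negP => /dart_stepE[[im _ iq hq] e [ix _] [Ti _ Tih]].
        have qE : q = oth g x by rewrite -(othK hw) e othK.
        have Tib : T i = b by move: Ti Tih; rewrite Th !inE => /orP[] /eqP -> //; rewrite eqxx.
        case/negP: ix; rewrite (pT i g q) ?Tib ?Tg // qE; exact: inc_oth.
      by rewrite hm (inc_ltn hm) //; apply: inc_oth.
  - case: IH => g Gg [al|inv]; exists g => //; first by left.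
    case: k1 inv ch st => [[[[T' f'] q] c] d] [ok1 [fm' fx' fq' Tf'] cd [atx offx] [p0 [s [ss np ps ls als]]]] ch st.
    case: (nstep_ok ok1 st) => ok2 _.
    case: st ok2 => h [hm hq T'h cr ->] ok2.
    have [gm gx Tg br] := Gg.
    have ab : a != b by rewrite -Tg eq_sym nax.
    have T'f' : T' f' = 0 by case: ok1.
    have c0 : c != 0 by case: cd => -[->].
    have hf' : h != f' by apply: contra_neq c0 => e; rewrite -T'h e.
    have cab : c \in [:: a; b] by case: cd => -[-> _]; rewrite !inE eqxx ?orbT.
    have dab : d \in [:: a; b] by case: cd => -[_ [-> _]]; rewrite !inE eqxx ?orbT.
    have cd' : c != d by case: cd => -[-> [-> _]]; rewrite // eq_sym.
    have qx : q != x by apply: contraNneq fx' => <-.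
    (* The walk returns to [x]. With colour [b] the edge is [f] and the path is complete; with
       colour [a] it would be [g], and then [f'], which had colour [b] at the same vertex, would be
       [g] as well. *)
    case hx : (inc h x).
      have qE : q = oth h x by apply: inc_neq.
      have [hga hfb] := atx h hm hx.
      case: cd => -[cE [dE]].
        by rewrite -(hfb _) ?T'h // -qE; left.
      have hg : h = g by apply: hga; rewrite T'h.
      have gq : inc g q by rewrite qE hg; apply: inc_oth.
      have f'g : f' = g by apply: (pT f' g q) => //; rewrite Tf' dE.
      by rewrite f'g gx in fx'.
    move/negbT in hx; right.
    have Thab : T h \in [:: a; b] by apply: offx => //; rewrite T'h.
    (* The edge of colour [d] at [q] in [T] is [f'], so [h] keeps its colour from [T] and the path
       goes on in [T]. *)
    have Thd : T h != d.
      apply: contra_neq hf' => Thd; apply: (pT h f' q); rewrite ?Thd //.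
      by move: dab; rewrite !inE => /orP[] /eqP ->.
    have Th : T h = c.
      by move: Thab cab dab Thd cd'; rewrite !inE; do 3 (case/orP => /eqP ->) => //; rewrite ?eqxx.
    split => //=.
    + by split=> //; apply: inc_oth.
    + have lk : link T x c q (oth h q) by exists h.
      case: cd => -[cE [dE]] => [al|[y al yq]]; [right|left]; do 2 split=> //.
        by exists q; rewrite // -cE.
      by apply: alt_rcons al yq _; rewrite -cE.
    + split=> i im ix.
        rewrite /upd; case: (eqVneq i h) ix => [->|_] ix; first by rewrite (negbTE hx) in ix.
        by case: (eqVneq i f') ix => [->|_] ix; [rewrite (negbTE fx') in ix|apply: atx].
      rewrite /upd; case: (eqVneq i h) => [-> //|_].
      by case: (eqVneq i f') => [->|_]; [rewrite Tf'|apply: offx].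
    + exists p0, (rcons s (h, oth h q)); split; rewrite ?size_rcons ?ss ?last_rcons //.
        rewrite rcons_path ps ls /dart_step /= fm' hm fq' hq eqxx fx' hx Thab Tf' dab /=.
        by rewrite Th eq_sym cd'.
      move: als; rewrite /= all_rcons => /andP[-> ->] /=; rewrite hm /= andbT.
      by apply: (inc_ltn hm); apply: inc_oth.
case: N ch NN main => [|[|j]] ch NN; [lia|lia|case=> g [gm gx Tg br] [al|inv]]; first by exists g.
case: k inv ch => [[[[T' f'] q] c] d] [_ _ _ _ [p0 [s [ss np ps ls /allP als]]]] ch.
(* The first two steps leave no counted predecessor, whence the summand [2] in the bound: [j.+1]
   distinct darts do not fit among [m * n] pairs. *)
have us := path_uniq np (fun u u' v => @dart_step_inj T x a b u u' v pT a0 b0) ps.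
have sub : {subset p0 :: s <= [seq (i, v) | i <- iota 0 m, v <- iota 0 n]}.
  move=> [i v] /als /= /andP[im vn]; apply/allpairsP; exists (i, v).
  by rewrite !mem_iota !add0n.
have := uniq_leq_size us sub; rewrite size_allpairs !size_iota /= ss.
by move: NN; lia.
Qed.

(** * Fans and their shifted colourings *)

(* A fan of [S] at [x] has vertices [z k] and edges [fe k]; the colouring [row k]
   arises from [S] by shifting colours along the fan so that [fe k] becomes the
   uncoloured edge. *)
Definition fan_entry (S : nat -> nat) x (z fe : nat -> nat) (row : nat -> nat -> nat) k :=
  [/\ [/\ fe k < m, inc (fe k) x, z k = oth (fe k) x & row k (fe k) = 0],
      okcol (row k) /\ Phi S <= Phi (row k),
      (forall h, h < m -> row k h != S h -> exists2 j, j <= k & h = fe j) /\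
      (forall h, h < m -> row k h != 0 -> row k h = S h \/
         exists2 j, j < k & h = fe j /\ row k h \in miss S (z j)),
      forall c, c != 0 -> used (row k) x c = used S x c &
      0 < k -> exists2 j, j < k & S (fe k) \in miss S (z j)].

Definition fan S x len z fe row :=
  (forall k, k < len -> fan_entry S x z fe row k) /\
  (forall i j, i < len -> j < len -> z i = z j -> i = j).

Lemma fan_entry_ext S x z fe row z' fe' row' k :
  (forall j, j <= k -> z j = z' j /\ fe j = fe' j) ->
  (forall h, h < m -> row k h = row' k h) ->
  fan_entry S x z fe row k -> fan_entry S x z' fe' row' k.
Proof.
move=> e er [[fm fx zk rf] [ok P] [d1 d2] us kp]; have [ez ef] := e k (leqnn k).
split; rewrite -?ez -?ef ?(eq_Phi er) //.
- by split; rewrite -?er.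
- split; first exact: eq_okcol ok.
  by move: P; rewrite (eq_Phi er).
- split=> h hm; rewrite -er //.
    by move=> /(d1 _ hm) [j jk ->]; exists j; rewrite // (e j jk).2.
  move=> /(d2 _ hm) [->|[j jk [-> hM]]]; [by left|right].
  by exists j; rewrite // -(e j (ltnW jk)).1 -(e j (ltnW jk)).2.
- by move=> c /us <-; apply: eq_used => h hm; rewrite er.
- by move=> /kp [j jk hM]; exists j; rewrite // -(e j (ltnW jk)).1.
Qed.

Lemma fan_init S x e z fe row :
  okcol S -> e < m -> inc e x -> S e = 0 -> z 0 = oth e x -> fe 0 = e ->
  (forall h, h < m -> row 0 h = S h) -> fan S x 1 z fe row.
Proof.
move=> ok em ex Se z0 fe0 r0; split=> [[|//] _|[|//] [|//] //].
have r0' h : h < m -> S h = row 0 h by move/r0.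
split; rewrite ?fe0 //.
- by split; rewrite // r0.
- by split; [exact: eq_okcol ok|rewrite (eq_Phi r0')].
- by split=> h hm; rewrite r0 // ?eqxx // => _; left.
- by move=> c _; apply: eq_used => h hm; rewrite r0.
Qed.

(** * Counting edges and missing colours *)

Definition cdeg v := \sum_(i < m) inc i v.
Definition coldeg (T : nat -> nat) v := \sum_(i < m) (inc i v && (T i != 0)).
Definition mult v w := \sum_(i < m) (inc i v && inc i w).
Definition colmult (T : nat -> nat) v w := \sum_(i < m) [&& inc i v, inc i w & T i != 0].

(** Different colours need different edges, so counting the edges that carry them suffices. *)
Lemma size_le_sum (s : seq nat) (p : pred nat) (T : nat -> nat) : uniq s ->
  (forall c, c \in s -> exists i, [/\ i < m, p i & T i = c]) ->
  size s <= \sum_(i < m) (p i && (T i \in s)).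
Proof.
move=> us sp; rewrite -(big_mkord xpredT (fun i => (p i && (T i \in s)) : nat)).
have -> : \sum_(0 <= i < m) (p i && (T i \in s)) = count (fun i => p i && (T i \in s)) (iota 0 m).
  rewrite -sum1_count [RHS]big_mkcond /= /index_iota subn0.
  by apply: eq_bigr => i _; case: (_ && _).
rewrite -size_filter -(size_map T [seq i <- _ | _]); apply: uniq_leq_size => // c /[dup] cs /sp[i [im pi Ti]].
by apply/mapP; exists i; rewrite // mem_filter pi mem_iota Ti cs.
Qed.

Lemma uniq_miss T v : uniq (miss T v).
Proof. exact: filter_uniq. Qed.

Lemma size_miss T v : size (F v) <= size (miss T v) + coldeg T v.
Proof.
have -> : size (F v) = size (miss T v) + size [seq c <- F v | used T v c].
  by rewrite !size_filter addnC count_predC.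
rewrite leq_add2l.
set s := [seq c <- _ | _]; have us : uniq s by apply: filter_uniq.
apply: leq_trans (size_le_sum (p := inc^~ v) (T := T) us _) _.
  by move=> c; rewrite mem_filter => /andP[/usedP[i [im iv Ti]] cF]; exists i.
apply: leq_sum => i _; case: (inc i v) => //=; case: eqP => [->|_]; last by case: (_ \in _).
by rewrite mem_filter (negbTE (F0 v)) andbF.
Qed.

Lemma coldeg_lt T v e : e < m -> inc e v -> T e = 0 -> coldeg T v < cdeg v.
Proof.
move=> em ev Te; rewrite /coldeg /cdeg (bigD1 (Ordinal em)) //= [ltnRHS](bigD1 (Ordinal em)) //=.
rewrite ev Te /= add0n add1n ltnS; apply: leq_sum => i _; by case: (inc i v) => //=; case: (_ != _).
Qed.

Lemma coldeg_le T v : coldeg T v <= cdeg v.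
Proof. by apply: leq_sum => i _; case: (inc i v) => //=; case: (_ != _). Qed.

Lemma colmult_le T v w : colmult T v w <= mult v w.
Proof. by apply: leq_sum => i _; do 2 case: (inc i _) => //=; case: (_ != _). Qed.

(** * The structure of a fan without improving walks *)

Section Fan.
Variables (S : nat -> nat) (x len : nat) (z fe : nat -> nat) (row : nat -> nat -> nat).
Hypothesis okS : okcol S.
Hypothesis Sfan : fan S x len z fe row.

Lemma fan_z k : k < len ->
  [/\ fe k < m, inc (fe k) x, inc (fe k) (z k), oth (fe k) (z k) = x & z k != x].
Proof.
move=> kl; have [[fm fx zk rf] _ _ _ _] := Sfan.1 k kl.
by rewrite zk othK // inc_oth // (oth_neq fm).
Qed.

Lemma fan_row_at k h : k < len -> h < m -> inc h (z k) -> h != fe k -> row k h = S h.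
Proof.
move=> kl hm hz hf; have [[fm fx zk rf] _ [d1 _] _ _] := Sfan.1 k kl.
apply/eqP/negP => /negP /(d1 _ hm) [j jk hj].
have jl := leq_ltn_trans jk kl; have [fjm fjx fjz foz zjx] := fan_z jl.
have [_ _ _ _ zkx] := fan_z kl.
have [[_ _ zj _] _ _ _ _] := Sfan.1 j jl.
move: hz; rewrite hj (incE fjx) (negbTE zkx) /= -zj => /eqP /(Sfan.2 _ _ kl jl) kj.
by rewrite hj kj eqxx in hf.
Qed.

Lemma fan_miss k : k < len -> {subset miss S (z k) <= miss (row k) (z k)}.
Proof.
move=> kl b /[dup] bM /missP[bF bS]; apply/missP; split=> // i im iz.
have [[fm fx zk rf] _ _ _ _] := Sfan.1 k kl.
case: (eqVneq i (fe k)) => [->|ik]; first by rewrite rf eq_sym (miss_neq0 bM).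
by rewrite (fan_row_at kl im iz ik) bS.
Qed.

(** The new row arises from [row k] by moving [b] from [g] to [fe k], so the colours used at [x]
    stay the same. The tables are compared only on old entries and on edges below [m], since the
    program overwrites parts of arrays. *)
Lemma fan_add k b g z' fe' row' :
  k < len -> b \in miss (row k) (z k) -> g < m -> inc g x -> S g = b ->
  (forall j, j < len -> z j != oth g x) ->
  (forall j, j < len -> z' j = z j /\ fe' j = fe j) ->
  (forall j, j < len -> forall h, h < m -> row' j h = row j h) ->
  z' len = oth g x -> fe' len = g ->
  (forall h, h < m -> row' len h = upd (upd (row k) (fe k) b) g 0 h) ->
  fan S x len.+1 z' fe' row'.
Proof.
move=> kl bM gm gx Sg gnew ezf er zl fl rl.
split; last first.
  move=> i j; rewrite !ltnS (leq_eqVlt i) (leq_eqVlt j) => /orP[/eqP -> |il] /orP[/eqP -> |jl] //.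
  - by rewrite zl (ezf j jl).1 => /esym /eqP; rewrite (negbTE (gnew j jl)).
  - by rewrite zl (ezf i il).1 => /eqP; rewrite (negbTE (gnew i il)).
  - by rewrite (ezf i il).1 (ezf j jl).1; apply: Sfan.2.
move=> i; rewrite ltnS leq_eqVlt => /orP[/eqP -> |il]; last first.
  apply: fan_entry_ext (Sfan.1 i il) => [j ji|h hm].
    by have [] := ezf j (leq_ltn_trans ji il).
  by rewrite er.
have [[fm fx zk rf] [ok P] [d1 d2] us kp] := Sfan.1 k kl.
have b0 := miss_neq0 bM; have [bF nb] := missP _ _ _ bM.
have [_ _ fz fo zx] := fan_z kl.
have gf : g != fe k by apply: contra (gnew k kl) => /eqP ->; rewrite zk.
have bS : b \in miss S (z k).
  apply/missP; split=> // i' im iz; case: (eqVneq i' (fe k)) => [->|ik].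
    by apply: contra_neq gf => Si; apply: (okS.1 g (fe k) x); rewrite // Sg.
  by rewrite -(fan_row_at kl im iz ik) nb.
(* The edge [g] leads to a vertex outside the fan, so no shift has touched it. *)
have rg : row k g = S g.
  apply/eqP/negP => /negP /(d1 _ gm) [j jk gj].
  have jl := leq_ltn_trans jk kl; have [[_ _ zj _] _ _ _ _] := Sfan.1 j jl.
  by case/eqP: (gnew j jl); rewrite zj -gj.
have gox : inc g (oth (fe k) (z k)) by rewrite fo.
have rgb : row k g = b by rewrite rg.
have [ok' P' _] := color_push ok fm rf fz bM gm gox rgb.
have rl' h : h < m -> upd (upd (row k) (fe k) b) g 0 h = row' len h by move/rl.
split; rewrite ?zl ?fl //.
- by split; rewrite // rl // /upd eqxx.
- split; first exact: eq_okcol ok'.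
  rewrite -(eq_Phi rl'); move: P P'; case: (b \in _); lia.
- split=> h hm; rewrite rl // /upd; case: (eqVneq h g) => [->|hg] //.
  + by exists len; rewrite ?fl.
  + case: (eqVneq h (fe k)) => [->|hf].
      by exists k; rewrite ?(ezf k kl).2 // ltnW.
    move=> /(d1 _ hm) [j jk ->]; have jl := leq_ltn_trans jk kl.
    by exists j; rewrite ?(ezf j jl).2 // ltnW.
  + case: (eqVneq h (fe k)) => [->|hf].
      by move=> _; right; exists k; rewrite ?(ezf k kl).2 ?(ezf k kl).1.
    move=> /(d2 _ hm) [->|[j jk [-> rj]]]; [by left|right].
    have jl := ltn_trans jk kl.
    by exists j; rewrite ?(ezf j jl).2 ?(ezf j jl).1.
- move=> c c0; rewrite -us // -(eq_used _ _ rl').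
  apply/usedP/usedP => -[i' [im ix]]; rewrite /upd.
    case: (eqVneq i' g) => [_ /esym c00|ig]; first by rewrite c00 eqxx in c0.
    case: (eqVneq i' (fe k)) => [_ <-|ik Ti]; first by exists g.
    by exists i'.
  case: (eqVneq i' g) => [->|ig Ti].
    by rewrite rgb => <-; exists (fe k); rewrite /upd eq_sym (negbTE gf) eqxx.
  exists i'; split=> //; rewrite /upd (negbTE ig).
  by case: (eqVneq i' (fe k)) Ti => // ->; rewrite rf => c00; rewrite -c00 eqxx in c0.
- by exists k; rewrite ?Sg ?(ezf k kl).1.
Qed.

(** The form in which failed attempts of the program are recorded: each walk outlasts the bound of
    [walk_stuck]. The colouring [T] agrees with [row k] on edge numbers only, because only these
    cells are copied. *)
Hypothesis stuck : forall k b a, k < len -> b \in miss (row k) (z k) -> a \in miss S x ->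
  exists T N k', [/\ forall h, h < m -> T h = row k h, chain (T, fe k, x, b, a) N k' &
                     m * n + 2 < N].

(** This is [walk_stuck] for [row k]; the path can be read in [S] because the two colourings differ
    only on edges at [x]. *)
Lemma fan_alt k b a : k < len -> b \in miss (row k) (z k) -> a \in miss S x ->
  exists g, [/\ g < m, inc g x, row k g = b, b \in F (oth g x) &
                alt S x a b (oth g x) (z k)].
Proof.
move=> kl bM aM; have [T [N [k' [TE ch NN]]]] := stuck kl bM aM.
have [[fm fx zk rf] [ok P] [d1 _] us _] := Sfan.1 k kl.
have TE' h : h < m -> row k h = T h by move/TE.
have [] := walk_stuck _ ch NN.
  split; rewrite ?TE -?zk //; first exact: eq_okcol ok.
  split; first by rewrite (eq_miss _ TE).
  have [aF _] := missP _ _ _ aM.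
  rewrite mem_filter aF (eq_used _ _ TE) us ?(miss_neq0 aM) // andbT.
  by move: aM; rewrite mem_filter => /andP[].
move=> g [gm gx Tg bg al]; exists g; split; rewrite -?TE // zk.
apply: alt_ext al => h hm hx; rewrite TE //; apply/eqP/negP => /negP /(d1 _ hm) [j jk hj].
have jl := leq_ltn_trans jk kl; have [_ fjx _ _ _] := fan_z jl.
by rewrite hj fjx in hx.
Qed.

Hypothesis a_miss : exists a, a \in miss S x.

Lemma fan_used k b : k < len -> b \in miss S (z k) ->
  exists g, [/\ g < m, inc g x & S g = b].
Proof.
move=> kl /[dup] bM /(fan_miss kl) bM'; have [a aM] := a_miss.
have [g [gm gx rg _ _]] := fan_alt kl bM' aM.
have [_ _ _ us _] := Sfan.1 k kl.
by apply/usedP; rewrite -us ?(miss_neq0 bM) //; apply/usedP; exists g.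
Qed.

(* Two entries missing the same colour would both be joined, by alternating
   paths off [x], to the end of the [b]-coloured edge at [x]. *)
Lemma fan_disjoint i j b : i < j -> j < len ->
  b \in miss S (z i) -> b \in miss S (z j) -> False.
Proof.
move: i b; have [j' jj'] := ubnP j; elim: j' j jj' => // j' IH j jj' i b ij jl bi bj.
have il := ltn_trans ij jl.
have [a aM] := a_miss; have a0 := miss_neq0 aM; have b0 := miss_neq0 bi.
have nolink k : k < len -> b \in miss S (z k) -> forall y, ~ link S x b (z k) y.
  by move=> kl /missP[_ nb] y [h [hm Sh hz _ _]]; move: (nb h hm hz); rewrite Sh eqxx.
have nolinkg g : g < m -> inc g x -> S g = b -> forall y, ~ link S x b (oth g x) y.
  move=> gm gx Sg y [h [hm Sh hz _ hx]]; have hg : h = g.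
    by apply: (okS.1 h g (oth g x)); rewrite ?Sh //; apply: inc_oth.
  by rewrite hg gx in hx.
have [gi [gim gix rgi _ ali]] := fan_alt il (fan_miss il bi) aM.
have [gj [gjm gjx rgj _ alj]] := fan_alt jl (fan_miss jl bj) aM.
have [_ _ [_ di] _ _] := Sfan.1 i il; have [_ _ [_ dj] _ _] := Sfan.1 j jl.
(* Otherwise [gi] is a fan edge that received [b] from an earlier vertex missing [b], and this
   smaller pair is excluded by induction. *)
have Sgi : S gi = b.
  have [||<- //|[k ki [_ rk]]] := di gi; rewrite ?rgi //.
  by case: (IH i _ k b ki il); rewrite ?rgi in rk *; rewrite // -ltnS (leq_trans _ jj').
have /(_ gjm) := dj gj; rewrite rgj => /(_ b0) [Sgj|[k kj [gjE rk]]].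
  have gij : gj = gi by apply: (okS.1 gj gi x); rewrite -?Sgj ?Sgi // -?Sgj.
  rewrite gij in alj.
  have := alt_fun okS.1 a0 b0 (nolink _ il bi) (nolink _ jl bj) ali alj.
  by move/(Sfan.2 _ _ il jl) => e; rewrite e ltnn in ij.
(* Here [b] was shifted onto [fe k], and induction forces [k = i]. The path from [z i] then ends
   both at [z j] and at the far end of [gi]; these coincide, although [b] is missing at the former
   and present at the latter. *)
have kl := ltn_trans kj jl.
have ki : k = i.
  case: (ltngtP k i) => // [ki|ik].
    by case: (IH i _ k b ki il rk bi); rewrite -ltnS (leq_trans _ jj').
  by case: (IH k _ i b ik kl bi rk); rewrite -ltnS (leq_trans _ jj').
have [[_ _ zi _] _ _ _ _] := Sfan.1 i il.
rewrite gjE ki -zi in alj.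
have zw := alt_fun okS.1 a0 b0 (nolinkg _ gim gix Sgi) (nolink _ jl bj) (alt_sym ali) alj.
have [_ nb] := missP _ _ _ bj.
by move: (nb gi gim); rewrite -zw inc_oth // Sgi eqxx => /(_ isT).
Qed.

Hypothesis z0_miss : exists b, b \in miss S (z 0).

(** For a later entry the colour is the one that [fe k] has in [S]. The stuck walk from the entry
    whose vertex misses this colour shows that it lies in the list of [z k], and in [row k] no edge
    at [z k] has it. *)
Lemma fan_miss_row k : k < len -> exists b, b \in miss (row k) (z k).
Proof.
case: k => [|k] kl; first by have [b bM] := z0_miss; exists b; apply: fan_miss.
have [a aM] := a_miss.
have [[fm fx zk rf] _ [d1 _] _ /(_ isT)[j jk bM]] := Sfan.1 _ kl.
set b := S (fe k.+1) in bM; have b0 := miss_neq0 bM.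
have jl := ltn_trans jk kl.
have [g [gm gx rg bF _]] := fan_alt jl (fan_miss jl bM) aM.
have [_ _ [dj _] _ _] := Sfan.1 _ jl.
have rb : row j (fe k.+1) = b.
  apply/eqP/negP => /negP /(dj _ fm) [i ij fei].
  have il := leq_ltn_trans ij jl; have [[_ _ zi _] _ _ _ _] := Sfan.1 _ il.
  have : z k.+1 = z i by rewrite zk zi fei.
  move/(Sfan.2 _ _ kl il) => ki; move: (leq_ltn_trans ij jk); rewrite -ki ltnn //.
have [_ [okj _] _ _ _] := Sfan.1 _ jl.
have gf : g = fe k.+1 by apply: (okj.1 g (fe k.+1) x); rewrite ?rb ?rg.
exists b; apply/missP; split; first by rewrite zk -gf.
move=> i im iz; case: (eqVneq i (fe k.+1)) => [->|ik]; first by rewrite rf eq_sym.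
rewrite (fan_row_at kl im iz ik); apply: contra_neq ik => Si.
have [_ _ fz _ _] := fan_z kl.
by apply: (okS.1 i (fe k.+1) (z k.+1)); rewrite // Si.
Qed.

(** The alternating path reaching [z k] ends with an edge of colour [a]. *)
Lemma fan_center k a : k < len -> a \in miss S x -> used S (z k) a.
Proof.
move=> kl aM; have [b bM] := fan_miss_row kl.
have [g [_ _ _ _ /alt_sym al]] := fan_alt kl bM aM.
have [y [h [hm Sh hz _ _]]] : exists y, link S x a (z k) y.
  by case: _ _ / al => {g} [v w lk|v w y u lk _ _]; [exists w|exists w].
by apply/usedP; exists h.
Qed.

Hypothesis closed : forall k b g, k < len -> b \in miss (row k) (z k) -> g < m ->
  inc g x -> S g = b -> exists2 j, j < len & z j = oth g x.

(** Each colour missing at a fan vertex occurs on an edge at [x], which leads into the fan by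
    [closed]; by [fan_disjoint] no edge is counted for two vertices. *)
Lemma fan_sum_miss :
  \sum_(k < len) size (miss S (z k)) <= \sum_(k < len) colmult S x (z k).
Proof.
have Mle (k : 'I_len) : size (miss S (z k)) <=
    \sum_(i < m) ([&& inc i x & S i != 0] && (S i \in miss S (z k))).
  apply: (size_le_sum (p := fun i => inc i x && (S i != 0)) (uniq_miss S (z k))) => c /[dup] cM /(fan_used (ltn_ord k))[g [gm gx Sg]].
  by exists g; rewrite gx Sg (miss_neq0 cM).
apply: (@leq_trans (\sum_(k < len) \sum_(i < m)
    ([&& inc i x & S i != 0] && (S i \in miss S (z k))))).
  by apply: leq_sum => k _; apply: Mle.
rewrite exchange_big [leqRHS]exchange_big; apply: leq_sum => i _ /=.
case ix : (inc i x) => /=; last by rewrite big1.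
case Si : (S i != 0) => /=; last by rewrite big1.
have [[k kM]|none] := pselect (exists k : 'I_len, S i \in miss S (z k)); last first.
  rewrite big1 // => k _; case Sk : (_ \in _) => //; by case: none; exists k.
rewrite (bigD1 k) //= big1 ?kM => [|j jk]; last first.
  case Sj : (_ \in _) => //; move: jk; rewrite -val_eqE /=.
  case: (ltngtP j k) => // jk _; first by case: (fan_disjoint jk (ltn_ord k) Sj kM).
  by case: (fan_disjoint jk (ltn_ord j) kM Sj).
have [j jl zj] := closed (ltn_ord k) (fan_miss (ltn_ord k) kM) (ltn_ord i) ix erefl.
by rewrite (bigD1 (Ordinal jl)) //= zj inc_oth.
Qed.

(** Among the coloured edges at [x], those whose colour is missing at [z k] do not lead to [z k]. *)
Lemma fan_miss_colmult k : k < len ->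
  size (miss S (z k)) + colmult S x (z k) <= coldeg S x.
Proof.
move=> kl; have us := uniq_miss S (z k).
apply: leq_trans (leq_add (size_le_sum (p := inc^~ x) (T := S) us _) (leqnn _)) _.
  by move=> c /(fan_used kl)[g [gm gx Sg]]; exists g.
rewrite -big_split; apply: leq_sum => i _ /=; case: (inc i x) => //=.
case cM : (_ \in _) => /=; last by case: (inc i (z k)).
have [_ nb] := missP _ _ _ cM; rewrite (miss_neq0 cM) andbT.
by case iz : (inc i (z k)) => //; move: (nb i (ltn_ord i) iz); rewrite eqxx.
Qed.

Lemma fan_miss2 j k : j < k -> k < len ->
  size (miss S (z j)) + size (miss S (z k)) <= coldeg S x.
Proof.
move=> jk kl; have jl := ltn_trans jk kl.
apply: leq_trans (leq_add (size_le_sum (p := inc^~ x) (T := S) (uniq_miss S (z j)) _)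
                          (size_le_sum (p := inc^~ x) (T := S) (uniq_miss S (z k)) _)) _.
- by move=> c /(fan_used jl)[g [gm gx Sg]]; exists g.
- by move=> c /(fan_used kl)[g [gm gx Sg]]; exists g.
rewrite -big_split; apply: leq_sum => i _ /=; case: (inc i x) => //=.
case cj : (S i \in miss S (z j)); case ck : (S i \in miss S (z k)) => //=.
- by case: (fan_disjoint jk kl cj ck).
- by rewrite (miss_neq0 cj).
- by rewrite (miss_neq0 ck).
Qed.

(** The same count seen from [z k]: every colour missing at [x] occurs there, on an edge that does
    not lead to [x]. *)
Lemma fan_center_colmult k : k < len ->
  size (miss S x) + colmult S x (z k) <= coldeg S (z k).
Proof.
move=> kl.
apply: leq_trans (leq_add (size_le_sum (p := inc^~ (z k)) (T := S) (uniq_miss S x) _) (leqnn _)) _.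
  by move=> c cM; have /usedP[g [gm gz Sg]] := fan_center kl cM; exists g.
rewrite -big_split; apply: leq_sum => i _ /=; case: (inc i (z k)) => //=; last by rewrite andbF.
case cM : (_ \in _) => /=; last by case: (inc i x).
have [_ nb] := missP _ _ _ cM; rewrite (miss_neq0 cM) andbT.
by case ix : (inc i x) => //; move: (nb i (ltn_ord i) ix); rewrite eqxx.
Qed.

(** Averaging over [fan_sum_miss]: one strict inequality already contradicts it, so the extra unit
    can be claimed at all entries but one. The first is exempted, as its uncoloured edge provides a
    unit anyway. *)
Lemma fan_heavy : 0 < len -> exists2 k, k < len & size (miss S (z k)) + (k != 0) <= colmult S x (z k).
Proof.
move=> l0; apply: contrapT => none.
suff : \sum_(k < len) colmult S x (z k) < \sum_(k < len) size (miss S (z k)).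
  by rewrite ltnNge fan_sum_miss.
have lt k : k < len -> colmult S x (z k) < size (miss S (z k)) + (k != 0).
  by move=> kl; rewrite ltnNge; apply/negP => le; apply: none; exists k.
rewrite (bigD1 (Ordinal l0)) //= [ltnRHS](bigD1 (Ordinal l0)) //= -addSn.
apply: leq_add; first by have := lt 0 l0; rewrite addn0.
apply: leq_sum => i; rewrite -val_eqE /= => i0; have := lt i (ltn_ord i).
by rewrite i0 addn1 ltnS.
Qed.

End Fan.

(** * Stuck fans contradict the three list conditions *)

Definition rich x e :=
  [\/ (forall v, v < n -> cdeg v + (cdeg v)./2 <= size (F v)) /\ cdeg x <= cdeg (oth e x),
      (exists mx : nat -> nat, forall v, v < n ->
        cdeg v + mx v <= size (F v) /\ forall w, v != w -> mult v w <= mx v) |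
      (forall v, v < n -> cdeg v <= size (F v)) /\
      exists side : nat -> bool, forall i, i < m -> side (E1 i) != side (E2 i)].

Lemma fan_stuck S x e len z fe row :
  okcol S -> e < m -> inc e x -> S e = 0 -> 0 < len -> z 0 = oth e x ->
  fan S x len z fe row ->
  (forall k b a, k < len -> b \in miss (row k) (z k) -> a \in miss S x ->
    exists T N k', [/\ forall h, h < m -> T h = row k h, chain (T, fe k, x, b, a) N k' &
                       m * n + 2 < N]) ->
  (forall k b g, k < len -> b \in miss (row k) (z k) -> g < m ->
    inc g x -> S g = b -> exists2 j, j < len & z j = oth g x) ->
  rich x e -> False.
Proof.
move=> ok em ex Se l0 z0 fn st cl cond.
have xn := inc_ltn em ex; have ey := inc_oth ex; have yn := inc_ltn em ey.
have Fdeg v : v < n -> cdeg v <= size (F v).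
  move=> vn; case: cond => [[H _]|[mx H]|[H _]]; last exact: H.
    by apply: leq_trans (H v vn); apply: leq_addr.
  by apply: leq_trans (H v vn).1; apply: leq_addr.
have ne v : v < n -> inc e v -> exists c, c \in miss S v.
  move=> vn ev; have := size_miss S v; have := coldeg_lt em ev Se; have := Fdeg v vn.
  case: (miss S v) => [|c s] /=; last by exists c; rewrite inE eqxx.
  lia.
have aM := ne x xn ex; have bM : exists b, b \in miss S (z 0) by rewrite z0; apply: ne.
have zE k : k < len -> z k < n /\ z k != x.
  by move=> kl; have [fm _ fz _ zx] := fan_z fn kl; split=> //; apply: inc_ltn fz.
case: cond => [[H dxy]|[mx H]|[_ [side sP]]].
- have [k kl hv] := fan_heavy ok fn st aM cl l0.
  have l1 := fan_miss_colmult fn st aM kl.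
  have l2 := coldeg_lt em ex Se.
  have s0 := size_miss S (z 0).
  have hx := H x xn; have h0 := H _ yn; rewrite -z0 in h0.
  have sx := size_miss S x.
  have ey0 : inc e (z 0) by rewrite z0.
  have l3 := coldeg_lt em ey0 Se.
  move: dxy; rewrite -z0 => dxy.
  have half d : exists2 h, d./2 = h & h + h <= d < h + h + 2.
    by exists d./2; rewrite // addnn -{2 3}[d]odd_double_half; case: (odd d); lia.
  have [ex2 exE exh] := half (cdeg x); have [e02 e0E e0h] := half (cdeg (z 0)).
  rewrite exE in hx; rewrite e0E in h0.
  (* If [k = 0], twice the number of colours missing at [z 0] is less than [cdeg x], hence than
     [cdeg (z 0)], while the list bound gives more than half of the latter. *)
  case: k kl hv l1 => [|k] kl hv l1; first by lia.
  have l4 := fan_miss2 ok fn st aM (ltn0Sn k) kl.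
  have l5 := fan_center_colmult ok fn st aM bM kl.
  have hk := H _ (zE _ kl).1; have sk := size_miss S (z k.+1).
  have [ek2 ekE ekh] := half (cdeg (z k.+1)); rewrite ekE in hk.
  exact: (shannon_arith exh e0h ekh dxy hx h0 hk sx s0 sk l2 l3 (coldeg_le _ _) hv l4 l5).
- have [k kl hv] := fan_heavy ok fn st aM cl l0.
  have [zn zx] := zE k kl; have [h1 /(_ x zx) h2] := H _ zn.
  have l1 := colmult_le S x (z k); have sk := size_miss S (z k).
  have mC : mult x (z k) = mult (z k) x by apply: eq_bigr => i _; rewrite andbC.
  case: k kl hv zn zx h1 h2 l1 sk mC => [|k] kl hv zn zx h1 h2 l1 sk mC.
    have ey0 : inc e (z 0) by rewrite z0.
    by apply: (vizing_arith h1 sk hv _ h2); [left; apply: coldeg_lt em ey0 Se|rewrite -mC].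
  apply: (vizing_arith h1 sk hv _ h2); [right; split; [exact: coldeg_le|by []]|by rewrite -mC].
(* Both [oth g x] and [oth e x] are neighbours of [x], so they lie on the same side, but the path
   joining them has odd length. *)
- have [a aS] := aM; have [b bS] := bM.
  have [g [gm gx _ _ al]] := fan_alt fn st l0 (fan_miss fn l0 bS) aS.
  have sE i v : i < m -> inc i v -> side (oth i v) = ~~ side v.
    move=> im /orP[] /eqP <-; rewrite /oth ?addKn ?addnK; move: (sP i im).
      by case: (side _); case: (side _).
    by case: (side _); case: (side _).
  have sl T c v w : link T x c v w -> side w = ~~ side v.
    by move=> [h [hm _ hv -> _]]; apply: sE.
  have sa v w : alt S x a b v w -> side w = ~~ side v.
    elim=> {v w} [v w /sl //|v w y u /sl e1 /sl e2 _ ->].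
    by rewrite e2 e1 negbK.
  have := sa _ _ al; rewrite z0 !sE //; by case: (side x).
Qed.

End CodedGraph.

(** * Loop programs *)

(* Every loop runs exactly [s 6 0] times and no loop body writes array 6: then
   running is a total function and the running time is bounded by a polynomial
   in [s 6 0] determined by the syntax. *)
Inductive lprog : Type :=
| LSkip
| LPut of nat & expr & expr
| LSeq of lprog & lprog
| LIf of expr & lprog & lprog
| LRep of nat & lprog.

Definition V r := Get r (Const 0).

Fixpoint compile (c : lprog) : prog :=
  match c with
  | LSkip => Skip
  | LPut a i v => Put a i v
  | LSeq c1 c2 => Seq (compile c1) (compile c2)
  | LIf u c1 c2 => If u (compile c1) (compile c2)
  | LRep r c =>
      Seq (Put r (Const 0) (Const 0))
          (While (Defs.Sub (V 6) (V r))
                 (Seq (compile c) (Put r (Const 0) (Add (V r) (Const 1)))))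
  end.

Definition incr r (s : store) := update s r 0 (s r 0).+1.

Fixpoint run (c : lprog) (s : store) : store :=
  match c with
  | LSkip => s
  | LPut a i v => update s a (eval s i) (eval s v)
  | LSeq c1 c2 => run c2 (run c1 s)
  | LIf u c1 c2 => if eval s u != 0 then run c1 s else run c2 s
  | LRep r c => iter (s 6 0) (fun s => incr r (run c s)) (update s r 0 0)
  end.

Fixpoint writes (c : lprog) : seq nat :=
  match c with
  | LSkip => [::]
  | LPut a _ _ => [:: a]
  | LSeq c1 c2 | LIf _ c1 c2 => writes c1 ++ writes c2
  | LRep r c => r :: writes c
  end.

Fixpoint wf (c : lprog) : bool :=
  match c with
  | LSkip => true
  | LPut a _ _ => a != 6
  | LSeq c1 c2 | LIf _ c1 c2 => wf c1 && wf c2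
  | LRep r c => [&& r \notin writes c, r != 6 & wf c]
  end.

Fixpoint duration (c : lprog) (B : nat) : nat :=
  match c with
  | LSkip => 1
  | LPut a i v => (cost i + cost v).+1
  | LSeq c1 c2 => duration c1 B + duration c2 B
  | LIf u c1 c2 => (cost u).+1 + (duration c1 B + duration c2 B)
  | LRep r c => 20 + B * (duration c B + 20)
  end.

Fixpoint reads (u : expr) : seq nat :=
  match u with
  | Const _ => [::]
  | Get a i => a :: reads i
  | Add u v | Defs.Sub u v => reads u ++ reads v
  end.

Lemma update_same s a i v : update s a i v a i = v.
Proof. by rewrite /update !eqxx. Qed.

Lemma update_frame s a i v b : b != a -> update s a i v b = s b.
Proof. by move=> ba; apply/funext => j; rewrite /update (negbTE ba). Qed.

Lemma updateE s a i v b j :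
  update s a i v b j = if (b == a) && (j == i) then v else s b j.
Proof. by []. Qed.

Lemma run_frame c s a : a \notin writes c -> run c s a = s a.
Proof.
elim: c s => [|b i v|c1 IH1 c2 IH2|u c1 IH1 c2 IH2|r c IH] s //=.
- by rewrite inE => ab; apply: update_frame.
- by rewrite mem_cat negb_or => /andP[n1 n2]; rewrite IH2 // IH1.
- by rewrite mem_cat negb_or => /andP[n1 n2]; case: ifP => _; [apply: IH1|apply: IH2].
- rewrite inE negb_or => /andP[ar nc]; elim: (s 6 0) => [|k IHk] /=; first exact: update_frame.
  by rewrite /incr update_frame // IH.
Qed.

Lemma wf_notin c : wf c -> 6 \notin writes c.
Proof.
elim: c => [|b i v|c1 IH1 c2 IH2|u c1 IH1 c2 IH2|r c IH] //=.
- by rewrite inE eq_sym.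
- by move=> /andP[/IH1 n1 /IH2 n2]; rewrite mem_cat negb_or n1.
- by move=> /andP[/IH1 n1 /IH2 n2]; rewrite mem_cat negb_or n1.
- by move=> /and3P[_ r6 /IH nc]; rewrite inE negb_or eq_sym r6.
Qed.

Lemma run_bound c s : wf c -> run c s 6 0 = s 6 0.
Proof. by move=> /wf_notin n6; rewrite run_frame. Qed.

Lemma exec_compile c s : wf c ->
  exists2 t, exec (compile c) s t (run c s) & t <= duration c (s 6 0).
Proof.
elim: c s => [|a i v|c1 IH1 c2 IH2|u c1 IH1 c2 IH2|r c IH] s.
- by exists 1 => //; constructor.
- by exists (cost i + cost v).+1 => //; constructor.
- move=> /= /andP[w1 w2]; have [t1 e1 l1] := IH1 s w1; have [t2 e2 l2] := IH2 (run c1 s) w2.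
  exists (t1 + t2); first exact: exec_seq e1 e2.
  by rewrite leq_add // -(run_bound s w1).
- move=> /andP[w1 w2] /=; case: ifP => eu.
    have [t1 e1 l1] := IH1 s w1; exists ((cost u).+1 + t1); first exact: exec_if_true e1.
    by rewrite leq_add2l (leq_trans l1) ?leq_addr.
  have [t2 e2 l2] := IH2 s w2; exists ((cost u).+1 + t2).
    by apply: exec_if_false e2; move/eqP: eu.
  by rewrite leq_add2l (leq_trans l2) ?leq_addl.
- move=> /= /and3P[rc r6 wc]; pose step s := incr r (run c s); pose B := s 6 0.
  (* A test costs 6 steps and an increment of the counter 6; the constants 10 and 20 leave some
     slack. *)
  have loop k s0 : s0 6 0 = B -> s0 r 0 + k = B -> exists2 t,
    exec (While (Defs.Sub (V 6) (V r)) (Seq (compile c) (Put r (Const 0) (Add (V r) (Const 1)))))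
      s0 t (iter k step s0) & t <= 10 + k * (duration c B + 20).
    elim: k s0 => [|k IHk] s0 s06 s0r.
      exists (cost (Defs.Sub (V 6) (V r))).+1 => //; apply: exec_while_false => /=.
      by rewrite s06 -s0r addn0 subnn.
    have [t1 e1 l1] := IH s0 wc; rewrite s06 in l1.
    have r1 : run c s0 r = s0 r by apply: run_frame.
    have [||t2 e2 l2] := IHk (step s0).
    + by rewrite /step /incr update_frame 1?eq_sym // run_bound.
    + by rewrite /step /incr update_same r1 addSnnS.
    rewrite iterSr; eexists.
      apply: exec_while_true e2; first by rewrite /= s06 -s0r addKn.
      apply: exec_seq e1 _; rewrite /step /incr -[(run c s0 r 0).+1]addn1.
      exact: (exec_put (run c s0) r (Const 0) (Add (V r) (Const 1))).
    by move: l1 l2; rewrite /= mulSn; lia.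
  have [||t et lt] := loop B (update s r 0 0).
  + by rewrite update_frame // eq_sym.
  + by rewrite update_same.
  exists (3 + t); last by move: lt; rewrite -/B; lia.
  apply: exec_seq et; exact: (exec_put s r (Const 0) (Const 0)).
Qed.

(** The invariant rule for bounded loops. Invariants have to ignore the counter [r], which is reset
    and incremented outside the body; arrays not written in the loop may be read as in [s]. *)
Lemma run_rep (I : nat -> store -> Prop) r c s : wf (LRep r c) ->
  (forall i s1 s2, (forall a, a != r -> s1 a = s2 a) -> I i s1 -> I i s2) ->
  I 0 s ->
  (forall i s', i < s 6 0 -> s' r 0 = i ->
     (forall a, a \notin writes (LRep r c) -> s' a = s a) -> I i s' -> I i.+1 (run c s')) ->
  I (s 6 0) (run (LRep r c) s).
Proof.
move=> /and3P[rc r6 wc] Ir I0 IS; rewrite /=; set step := fun s => _; set s0 := update s r 0 0.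
suff loop k : k <= s 6 0 -> [/\ iter k step s0 r 0 = k,
    forall a, a \notin writes (LRep r c) -> iter k step s0 a = s a & I k (iter k step s0)].
  by have [] := loop (s 6 0) (leqnn _).
elim: k => [_|k IHk kB] /=.
  split; first by rewrite /s0 update_same.
    by move=> a; rewrite inE negb_or => /andP[ar _]; rewrite /s0 update_frame.
  by apply: Ir I0 => a ar; rewrite /s0 update_frame.
have [kr kf kI] := IHk (ltnW kB).
have r1 : run c (iter k step s0) r = iter k step s0 r by apply: run_frame.
split; first by rewrite {1}/step /incr update_same r1 kr.
  move=> a /[dup] aW; rewrite inE negb_or => /andP[ar ac].
  by rewrite {1}/step /incr update_frame // run_frame // kf.
apply: Ir (IS _ _ kB kr kf kI) => a ar.
by rewrite {2}/step /incr update_frame.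
Qed.

Lemma eval_frame s s' u : (forall a, a \in reads u -> s a = s' a) -> eval s u = eval s' u.
Proof.
elim: u => [//|a i IH|u1 IH1 u2 IH2|u1 IH1 u2 IH2] /= e.
- rewrite IH ?e ?inE ?eqxx // => b bi; apply: e; by rewrite inE bi orbT.
- by rewrite IH1 ?IH2 // => b bi; apply: e; rewrite mem_cat bi ?orbT.
- by rewrite IH1 ?IH2 // => b bi; apply: e; rewrite mem_cat bi ?orbT.
Qed.

(** Truth is being nonzero, as in the machine's tests, so some of these values exceed 1; the
    conjunction and the negation cut them down by truncated subtraction from 1. *)
Definition EEq u v := Defs.Sub (Const 1) (Add (Defs.Sub u v) (Defs.Sub v u)).
Definition ELt u v := Defs.Sub v u.
Definition ELe u v := Defs.Sub (Add v (Const 1)) u.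
Definition EAnd u v := Defs.Sub (Const 1) (Add (Defs.Sub (Const 1) u) (Defs.Sub (Const 1) v)).
Definition EOr u v := Add u v.
Definition ENot u := Defs.Sub (Const 1) u.

Lemma eval_EEq s u v : (eval s (EEq u v) != 0) = (eval s u == eval s v).
Proof. rewrite /=; lia. Qed.
Lemma eval_ELt s u v : (eval s (ELt u v) != 0) = (eval s u < eval s v).
Proof. rewrite /=; lia. Qed.
Lemma eval_ELe s u v : (eval s (ELe u v) != 0) = (eval s u <= eval s v).
Proof. rewrite /=; lia. Qed.
Lemma eval_EAnd s u v : (eval s (EAnd u v) != 0) = (eval s u != 0) && (eval s v != 0).
Proof. rewrite /=; lia. Qed.
Lemma eval_EOr s u v : (eval s (EOr u v) != 0) = (eval s u != 0) || (eval s v != 0).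
Proof. rewrite /=; lia. Qed.
Lemma eval_ENot s u : (eval s (ENot u) != 0) = (eval s u == 0).
Proof. rewrite /=; lia. Qed.
Definition evalE := (eval_EEq, eval_ELt, eval_ELe, eval_EAnd, eval_EOr, eval_ENot).

(** * Polynomial bounds on running times *)

Definition polybound (g : nat -> nat -> nat) :=
  exists q : {poly {poly nat}}, forall d k, g d k = eval2 q d k.

Lemma polybound_const c : polybound (fun _ _ => c).
Proof.
exists (c%:P)%:P%R => d k; by rewrite /eval2 !hornerC.
Qed.

Lemma polybound_fst : polybound (fun d _ => d).
Proof. by exists ('X%:P)%R => d k; rewrite /eval2 hornerC hornerX. Qed.

Lemma polybound_snd : polybound (fun _ k => k).
Proof. by exists ('X)%R => d k; rewrite /eval2 hornerX hornerC. Qed.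

Lemma polyboundD g h : polybound g -> polybound h -> polybound (fun d k => g d k + h d k).
Proof.
by move=> [p pE] [q qE]; exists (p + q)%R => d k; rewrite /eval2 !hornerD pE qE.
Qed.

Lemma polyboundM g h : polybound g -> polybound h -> polybound (fun d k => g d k * h d k).
Proof.
by move=> [p pE] [q qE]; exists (p * q)%R => d k; rewrite /eval2 !hornerM pE qE.
Qed.

Lemma polybound_duration c g : polybound g -> polybound (fun d k => duration c (g d k)).
Proof.
move=> gP; elim: c => [|a i v|c1 IH1 c2 IH2|u c1 IH1 c2 IH2|r c IH] /=.
- exact: polybound_const.
- exact: polybound_const.
- exact: polyboundD.
- by apply: polyboundD; [exact: polybound_const|exact: polyboundD].
- apply: polyboundD; first exact: polybound_const.
  by apply: polyboundM => //; apply: polyboundD => //; apply: polybound_const.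
Qed.

Lemma duration_mono c B B' : B <= B' -> duration c B <= duration c B'.
Proof.
move=> BB; elim: c => [|a i v|c1 IH1 c2 IH2|u c1 IH1 c2 IH2|r c IH] //=.
- exact: leq_add.
- by rewrite leq_add2l leq_add.
- by rewrite leq_add2l leq_mul // leq_add2r.
Qed.

(** * The colouring program *)

Local Notation "r <~ e" := (LPut r (Const 0) e) (at level 62).
Local Notation "c1 ;; c2" := (LSeq c1 c2) (at level 63, right associativity).

Ltac simpl_store := rewrite /=; repeat (rewrite !updateE /=).

(* Colours are stored increased by one, 0 meaning uncoloured.  Array 7 is the
   current colouring and 8 a working copy.  The k-th fan entry has its vertex in
   cell k of array 10, its edge in cell k of array 11 and its shifted colouring
   in array 9 from cell k|E| on; array 12 marks the vertices of the fan.
   Registers are cells 0 of the other arrays: 20 and 21 hold the uncoloured edge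
   of a walk and the end to walk to, 22 and 23 its next two colours, 24 tells that
   the walk has increased Phi and 25 that array 7 has been improved; 26 is the
   length of the fan, 27 its centre, 28 and 29 the offsets in array 9 of the
   current entry and of the next free one. *)
Definition num_edges := Get 0 (Const 1).

(** Register 31 receives the edge number plus one, so that 0 can signal failure and the register
    serves as a test. *)
Definition find_prog a v c :=
  31 <~ Const 0;;
  LRep 30 (LIf (EAnd (ELt (V 30) num_edges)
                 (EAnd (EEq (Get a (V 30)) c)
                       (EOr (EEq (Get 1 (V 30)) v) (EEq (Get 2 (V 30)) v))))
            (31 <~ Add (V 30) (Const 1)) LSkip).

Definition in_list v i := EAnd (ELe (Get 3 v) i) (ELt i (Get 3 (Add v (Const 1)))).

Definition mem_prog v c :=
  33 <~ Const 0;;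
  LRep 32 (LIf (EAnd (in_list v (V 32)) (EEq (Add (Get 4 (V 32)) (Const 1)) c))
             (33 <~ Const 1) LSkip).

Definition copy_prog dst doff src soff :=
  LRep 34 (LIf (ELt (V 34) num_edges)
             (LPut dst (Add doff (V 34)) (Get src (Add soff (V 34)))) LSkip).

Definition other_end g v := Defs.Sub (Add (Get 1 g) (Get 2 g)) v.

Definition push_prog :=
  35 <~ Defs.Sub (V 31) (Const 1);;
  36 <~ other_end (V 35) (V 21);;
  LPut 8 (V 20) (V 22);;
  LPut 8 (V 35) (Const 0).

Definition move_prog :=
  20 <~ V 35;; 21 <~ V 36;; 37 <~ V 22;; 22 <~ V 23;; 23 <~ V 37.

Definition step_prog :=
  find_prog 8 (V 21) (V 22);;
  LIf (V 31)
    (push_prog;;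
     mem_prog (V 36) (V 22);;
     LIf (V 33) move_prog (24 <~ Const 1))
    (LPut 8 (V 20) (V 22);; 24 <~ Const 1).

(** Two nested loops allow the square of the loop bound many steps, enough for [walk_stuck]; once
    register 24 is set, the remaining rounds do nothing. *)
Definition walk_prog :=
  24 <~ Const 0;; LRep 46 (LRep 47 (LIf (V 24) LSkip step_prog)).

Definition load_prog :=
  20 <~ Get 11 (V 43);; 21 <~ V 27;; 22 <~ V 50;; 23 <~ V 51.

(** Register 45 runs through all positions of array 4 and supplies the colour at the centre;
    register 44 does the same for the fan vertex, and 43 for the fan entries. *)
Definition attempt_prog :=
  LIf (EAnd (in_list (V 27) (V 45)) (ENot (V 25)))
    (51 <~ Add (Get 4 (V 45)) (Const 1);;
     find_prog 7 (V 27) (V 51);;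
     LIf (V 31) LSkip
       (copy_prog 8 (Const 0) 9 (V 28);;
        load_prog;;
        walk_prog;;
        LIf (V 24) (copy_prog 7 (Const 0) 8 (Const 0);; 25 <~ Const 1) LSkip))
    LSkip.

Definition add_row_prog :=
  copy_prog 8 (Const 0) 9 (V 28);;
  LPut 8 (Get 11 (V 43)) (V 50);;
  LPut 8 (V 35) (Const 0);;
  copy_prog 9 (V 29) 8 (Const 0);;
  LPut 10 (V 26) (V 36);;
  LPut 11 (V 26) (V 35);;
  LPut 12 (V 36) (Const 1);;
  26 <~ Add (V 26) (Const 1);;
  29 <~ Add (V 29) num_edges.

Definition extend_prog :=
  LIf (V 25) LSkip
    (find_prog 7 (V 27) (V 50);;
     LIf (V 31)
       (35 <~ Defs.Sub (V 31) (Const 1);;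
        36 <~ other_end (V 35) (V 27);;
        LIf (Get 12 (V 36)) LSkip add_row_prog)
       LSkip).

Definition color_prog :=
  LIf (EAnd (in_list (Get 10 (V 43)) (V 44)) (ENot (V 25)))
    (50 <~ Add (Get 4 (V 44)) (Const 1);;
     copy_prog 8 (Const 0) 9 (V 28);;
     find_prog 8 (Get 10 (V 43)) (V 50);;
     LIf (V 31) LSkip (LRep 45 attempt_prog;; extend_prog))
    LSkip.

Definition entry_prog :=
  LIf (EAnd (ELt (V 43) (V 26)) (ENot (V 25))) (LRep 44 color_prog) LSkip;;
  28 <~ Add (V 28) num_edges.

Definition start_prog i2 :=
  LPut 10 (Const 0) (Get i2 (V 41));;
  LPut 11 (Const 0) (V 41);;
  LPut 12 (Get i2 (V 41)) (Const 1);;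
  26 <~ Const 1;;
  28 <~ Const 0;;
  29 <~ num_edges.

Definition init_prog i1 i2 :=
  27 <~ Get i1 (V 41);;
  LRep 42 (LPut 12 (V 42) (Const 0));;
  start_prog i2;;
  copy_prog 9 (Const 0) 7 (Const 0).

(** The arguments name the endpoint arrays, so that either end of an edge can serve as centre; the
    Shannon bound needs the end of smaller degree. *)
Definition side_prog i1 i2 :=
  LIf (V 25) LSkip (init_prog i1 i2;; LRep 43 entry_prog).

Definition edge_prog :=
  LIf (EAnd (ELt (V 41) num_edges) (EEq (Get 7 (V 41)) (Const 0)))
    (side_prog 1 2;; side_prog 2 1) LSkip.

Definition round_prog := 25 <~ Const 0;; LRep 41 edge_prog.

Definition main_prog :=
  LRep 40 round_prog;;
  LRep 48 (LPut 5 (V 48) (Defs.Sub (Get 7 (V 48)) (Const 1))).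

Lemma wf_main : wf main_prog. Proof. by []. Qed.

Lemma runK s : run LSkip s = s. Proof. by []. Qed.
Lemma runS c1 c2 s : run (c1;; c2) s = run c2 (run c1 s). Proof. by []. Qed.
Lemma runP a i v s : run (LPut a i v) s = update s a (eval s i) (eval s v). Proof. by []. Qed.
Lemma runI u c1 c2 s : run (LIf u c1 c2) s = if eval s u != 0 then run c1 s else run c2 s.
Proof. by []. Qed.

Lemma eval_in_list s v i :
  (eval s (in_list v i) != 0) = (s 3 (eval s v) <= eval s i < s 3 (eval s v).+1).
Proof. rewrite /in_list eval_EAnd eval_ELe eval_ELt /=. by rewrite addn1. Qed.

#[local] Arguments run : simpl never.

(** * Correctness of the basic routines and of the walks *)

Section Correctness.
Variables (n m : nat) (E1 E2 lo col : nat -> nat) (B : nat).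
Hypothesis E1n : forall i, i < m -> E1 i < n.
Hypothesis E2n : forall i, i < m -> E2 i < n.
Hypothesis E12 : forall i, i < m -> E1 i != E2 i.

Definition color_list v := [seq (col i).+1 | i <- iota (lo v) (lo v.+1 - lo v)].
Local Notation F := color_list.

Hypothesis Funiq : forall v, uniq (F v).
Hypothesis loB : forall v, v < n -> lo v.+1 <= B.
Hypothesis nB : n <= B.
Hypothesis mB : m <= B.
Hypothesis walkB : m * n + 2 < B * B.
Hypothesis roundB : m.*2 < B.

Local Notation inc := (inc E1 E2).
Local Notation oth := (oth E1 E2).
Local Notation used := (used m E1 E2).
Local Notation miss := (miss m E1 E2 F).
Local Notation okcol := (okcol m E1 E2 F).
Local Notation Phi := (Phi m E1 E2 F).
Local Notation okcfg := (okcfg m E1 E2 F).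
Local Notation nstep := (nstep m E1 E2 F).
Local Notation chain := (chain m E1 E2 F).
Local Notation fan := (fan m E1 E2 F).

Lemma F0 v : 0 \notin F v.
Proof. by apply/mapP => -[]. Qed.

Lemma mem_F v c : reflect (exists i, [/\ lo v <= i < lo v.+1 & (col i).+1 = c]) (c \in F v).
Proof.
apply: (iffP mapP) => [[i]|[i [iv <-]]].
  by rewrite mem_iota => iv ->; exists i; split=> //; lia.
by exists i => //; rewrite mem_iota; lia.
Qed.

Definition inst (s : store) :=
  [/\ s 0 0 = n, s 0 1 = m, s 1 = E1 /\ s 2 = E2, s 3 = lo /\ s 4 = col & s 6 0 = B].

Lemma inst_frame (s s' : store) :
  (forall a, a \in [:: 0; 1; 2; 3; 4; 6] -> s' a = s a) -> inst s -> inst s'.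
Proof. by move=> e [? ? [? ?] [? ?] ?]; split; rewrite ?e. Qed.

Lemma inst_run c s : all (fun a => a \notin writes c) [:: 0; 1; 2; 3; 4; 6] ->
  inst s -> inst (run c s).
Proof. by move=> /allP n6; apply: inst_frame => a /n6; apply: run_frame. Qed.

Definition indep (ws : seq nat) u := all (fun a => a \notin ws) (reads u).

Lemma eval_indep ws s s' u : indep ws u -> (forall a, a \notin ws -> s' a = s a) ->
  eval s' u = eval s u.
Proof. by move=> /allP ind e; apply: eval_frame => a /ind; apply: e. Qed.

Lemma run_find a v c s : inst s -> a \notin [:: 30; 31] ->
  indep [:: 30; 31] v -> indep [:: 30; 31] c ->
  (run (find_prog a v c) s 31 0 = 0 /\ ~~ used (s a) (eval s v) (eval s c)) \/
  (exists g, [/\ g < m, run (find_prog a v c) s 31 0 = g.+1,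
                 inc g (eval s v) & s a g = eval s c]).
Proof.
move=> ins na iv ic; rewrite /find_prog runS.
set s0 := run _ s; have f0 b : b \notin [:: 31] -> s0 b = s b by move=> nb; rewrite /s0 run_frame.
have [_ _ _ _ sB] := ins; have s0B : s0 6 0 = B by rewrite f0.
set c0 := LRep _ _.
pose I i (s' : store) :=
  (s' 31 0 = 0 /\ forall g, g < i -> g < m -> inc g (eval s v) -> s a g <> eval s c) \/
  (exists g, [/\ g < m, s' 31 0 = g.+1, inc g (eval s v) & s a g = eval s c]).
have : I (s0 6 0) (run c0 s0).
  apply: run_rep => //.
  - by move=> i s1 s2 e; rewrite /I -e.
  - by left; split.
  move=> i s' iB ri fr II.
  have fr' b : b \notin [:: 30; 31] -> s' b = s b.
    by move=> bn; rewrite fr ?f0 //; move: bn; rewrite !inE !negb_or => /andP[].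
  have [_ sm [e1 e2] _ _] := ins.
  rewrite runI !evalE !(eval_indep iv fr') !(eval_indep ic fr') /= ri !fr' // sm e1 e2.
  case: ifP => [/and3P[im /eqP ci iiv]|no].
    by right; exists i; rewrite runP update_same /= ri addn1.
  case: II => [[z0 none]|]; last by right.
  left; split=> // g; rewrite ltnS leq_eqVlt => /orP[/eqP ->|]; last exact: none.
  by move=> im iiv ci; move: no; rewrite im ci eqxx -/(inc i _) iiv.
rewrite /I s0B => -[[z0 none]|]; last by right.
left; split=> //; apply/usedP => -[g [gm gv sg]].
by apply: (none g) => //; apply: leq_trans mB.
Qed.

Lemma run_mem v c s : inst s -> indep [:: 32; 33] v -> indep [:: 32; 33] c -> eval s v < n ->
  (run (mem_prog v c) s 33 0 != 0) = (eval s c \in F (eval s v)).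
Proof.
move=> ins iv ic vn; rewrite /mem_prog runS.
set s0 := run _ s; have f0 b : b \notin [:: 33] -> s0 b = s b by move=> nb; rewrite /s0 run_frame.
have [_ _ _ _ sB] := ins; have s0B : s0 6 0 = B by rewrite f0.
set c0 := LRep _ _.
pose I i (s' : store) := (s' 33 0 != 0) = has (fun j => [&& lo (eval s v) <= j, j < lo (eval s v).+1
  & (col j).+1 == eval s c]) (iota 0 i).
have : I (s0 6 0) (run c0 s0).
  apply: run_rep => //.
  - by move=> i s1 s2 e; rewrite /I -e.
  move=> i s' iB ri fr II.
  have fr' b : b \notin [:: 32; 33] -> s' b = s b.
    by move=> bn; rewrite fr ?f0 //; move: bn; rewrite !inE !negb_or => /andP[].
  have [_ _ _ [e3 e4] _] := ins.
  rewrite /I -[i.+1]addn1 iotaD has_cat has_seq1 add0n -II.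
  rewrite runI eval_EAnd eval_in_list eval_EEq !(eval_indep ic fr') !(eval_indep iv fr') /= ri.
  rewrite (fr' 3) // (fr' 4) // e3 e4 !addn1 -andbA.
  by case: ifP => [|_]; rewrite ?orbT ?orbF.
rewrite /I s0B => ->; apply/hasP/mem_F => [[i _ /and3P[l u /eqP c']]|[i [/andP[l u] c']]].
  by exists i; rewrite l u.
exists i; last by rewrite l u c' eqxx.
by rewrite mem_iota /= add0n (leq_trans u) // loB.
Qed.

(** The equation covers every cell of [dst], because adding a row to array 9 has to preserve the
    earlier rows. *)
Lemma run_copy dst doff src soff s j : inst s -> dst \notin [:: 0; 34; src] -> dst != 6 -> src != 34 ->
  indep [:: 34; dst] doff -> indep [:: 34; dst] soff ->
  run (copy_prog dst doff src soff) s dst j =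
    if eval s doff <= j < eval s doff + m then s src (eval s soff + (j - eval s doff)) else s dst j.
Proof.
move=> ins nd d6 nsrc id_ is_; have [_ sm _ _ sB] := ins.
have [d0 d34 dsrc] : [/\ dst != 0, dst != 34 & dst != src].
  by move: nd; rewrite !inE !negb_or => /and3P[].
pose I i (s' : store) := forall j, s' dst j =
  if eval s doff <= j < eval s doff + minn i m then s src (eval s soff + (j - eval s doff)) else s dst j.
have : I (s 6 0) (run (copy_prog dst doff src soff) s).
  apply: run_rep => //.
  - by rewrite /= !inE eq_sym d34 d6.
  - by move=> i s1 s2 e; rewrite /I => II j'; rewrite -e ?II.
  - by move=> j'; rewrite min0n addn0; case: ifP => //; lia.
  move=> i s' iB ri fr II j'.
  have fr' b : b \notin [:: 34; dst] -> s' b = s b.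
    by move=> bn; rewrite fr //= cats0.
  rewrite runI runP !evalE /= !(eval_indep id_ fr') !(eval_indep is_ fr') ri.
  have -> : s' 0 = s 0 by apply: fr'; rewrite !inE negb_or /= eq_sym.
  rewrite sm.
  have srcE : s' src = s src by apply: fr'; rewrite !inE negb_or nsrc eq_sym.
  case: ifP => im; last first.
    by rewrite runK II; have -> : minn i.+1 m = minn i m by lia.
  rewrite updateE eqxx /=; case: eqP => [->|ne]; last first.
    by rewrite II; case: ifP => c1; case: ifP => c2 //; lia.
  by rewrite srcE addKn ifT //; lia.
by rewrite sB => ->; have -> : minn B m = m by lia.
Qed.

Lemma update_upd s a i v : update s a i v a = upd (s a) i v.
Proof. by apply/funext => j; rewrite /update eqxx /upd. Qed.

Definition cfgof (s : store) : cfg := (s 8, s 20 0, s 21 0, s 22 0, s 23 0).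

Lemma run_push s g : s 31 0 = g.+1 ->
  [/\ run push_prog s 35 0 = g, run push_prog s 36 0 = s 1 g + s 2 g - s 21 0 &
      run push_prog s 8 = upd (upd (s 8) (s 20 0) (s 22 0)) g 0].
Proof.
move=> s31; rewrite /push_prog !runS !runP /=; split.
- by rewrite !updateE /= s31 subn1.
- by rewrite !updateE /= s31 subn1.
by apply/funext => j; rewrite !updateE /= s31 subn1.
Qed.

Lemma run_move s :
  cfgof (run move_prog s) = (s 8, s 35 0, s 36 0, s 23 0, s 22 0).
Proof.
have -> : cfgof (run move_prog s) = (s 8, run move_prog s 20 0, run move_prog s 21 0,
    run move_prog s 22 0, run move_prog s 23 0) by rewrite /cfgof run_frame.
by rewrite /move_prog !runS !runP /= !updateE.
Qed.

Definition improved (T : nat -> nat) (s : store) :=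
  [/\ s 24 0 != 0, okcol (s 8) & Phi T < Phi (s 8)].

(** If no edge at the end in question has the colour, [color_free] gives the gain; otherwise the
    membership test separates, by [color_push], the steps that gain from those that form an
    [nstep]. *)
Lemma run_step s : inst s -> okcfg (cfgof s) ->
  s 24 0 = 0 ->
  (run step_prog s 24 0 = 0 /\ nstep (cfgof s) (cfgof (run step_prog s))) \/
  improved (s 8) (run step_prog s).
Proof.
move=> ins [ok fm Tf fq [cp dq]] d0; rewrite /step_prog runS.
have fp : inc (s 20 0) (oth (s 20 0) (s 21 0)) by apply: inc_oth.
have qE : oth (s 20 0) (oth (s 20 0) (s 21 0)) = s 21 0 by apply: othK.
have := @run_find 8 (V 21) (V 22) s ins isT isT isT.
set s1 := run (find_prog _ _ _) s => r1.
have f1 a : a \notin [:: 31; 30; 31] -> s1 a = s a by move=> na; rewrite /s1 run_frame.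
case: r1 => [[z0 nu]|[g [gm zg gq sg]]]; rewrite runI.
  right; rewrite [eval _ _]/= z0 /= runS !runP /improved !updateE /= (update_frame _ _ _ (isT : 8 != 24)) update_upd.
  rewrite (f1 8) // (f1 20) // (f1 22) //.
  have [] := @color_free m E1 E2 F F0 (s 8) (s 20 0) (oth (s 20 0) (s 21 0)) (s 22 0) ok fm Tf fp cp.
    by rewrite qE.
  by [].
rewrite /= in gq sg.
have [] := @color_push m E1 E2 F F0 (s 8) (s 20 0) (oth (s 20 0) (s 21 0)) (s 22 0) g ok fm Tf fp cp gm.
- by rewrite qE.
- by [].
rewrite qE => ok' P' _.
have -> : eval s1 (V 31) = g.+1 by rewrite /= zg.
rewrite [_ != 0]/= runS.
have [s2g s2r s28] := run_push zg.
set s2 := run push_prog s1 in s2g s2r s28 *.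
have f2 a : a \notin [:: 35; 36; 8; 8] ++ [:: 31; 30; 31] -> s2 a = s a.
  by rewrite mem_cat negb_or => /andP[n1 n2]; rewrite /s2 run_frame ?f1.
have [_ _ [e1 e2] _ _] := ins.
move: s2r s28; rewrite !f1 // e1 e2 -/(oth _ _) => s2r s28.
have ins2 : inst s2 by apply: inst_frame ins => a aa; apply: f2; move: a aa; apply/allP.
have rn : oth g (s 21 0) < n by apply: (inc_ltn E1n E2n gm); apply: inc_oth.
have := @run_mem (V 36) (V 22) s2 ins2 isT isT.
rewrite [eval s2 (V 36)]/= [eval s2 (V 22)]/= s2r f2 // => /(_ rn).
set s3 := run (mem_prog _ _) s2 => r3.
have f3 a : a \notin [:: 33; 32; 33] -> s3 a = s2 a by move=> na; rewrite /s3 run_frame.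
rewrite runS -/s3 runI r3; case: ifP => cr.
  left; split; first by rewrite run_frame // f3 // f2.
  exists g; split=> //; rewrite run_move !f3 // s28 s2g s2r.
  by rewrite (f2 22) // (f2 23).
right; rewrite runP; split; first by rewrite update_same.
  by rewrite update_frame // f3 // s28.
rewrite update_frame // f3 // s28; move: P'; rewrite cr; lia.
Qed.

Definition walk_inv s0 N (s : store) :=
  improved (s0 8) s \/ s 24 0 = 0 /\ chain (cfgof s0) N (cfgof s).

Lemma walk_inv_indep r s0 N s1 s2 : r \notin [:: 8; 20; 21; 22; 23; 24] ->
  (forall a, a != r -> s1 a = s2 a) -> walk_inv s0 N s1 -> walk_inv s0 N s2.
Proof.
move=> rn e; have e' a : a \in [:: 8; 20; 21; 22; 23; 24] -> s2 a = s1 a.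
  by move=> ain; rewrite e //; apply: contraNneq rn => <-.
by rewrite /walk_inv /improved /cfgof !e'.
Qed.

Lemma run_walk_inner s0 N s : okcfg (cfgof s0) -> inst s -> walk_inv s0 N s ->
  walk_inv s0 (N + B) (run (LRep 47 (LIf (V 24) LSkip step_prog)) s).
Proof.
move=> ok0 ins inv; have [_ _ _ _ sB] := ins; rewrite -{1}sB.
apply: (run_rep (I := fun i => walk_inv s0 (N + i))) => //; last 1 first.
- move=> i s' iB ri fr inv'; rewrite runI.
  have ins' : inst s' by apply: inst_frame ins => a aa; apply: fr; move: a aa; apply/allP.
  case: inv' => [[d0 okT P]|[d0 ch]]; first by rewrite /= d0; left; split.
  rewrite /= d0 /=; have [okc Pc] := chain_ok E12 F0 ok0 ch.
  have [[d1 st]|[d1 ok1 P1]] := run_step ins' okc d0.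
    by right; split=> //; rewrite addnS; apply: chainS ch st.
  by left; split=> //; move: P1; rewrite Pc.
- by move=> i s1 s2; apply: walk_inv_indep.
- by rewrite addn0.
Qed.

Lemma run_walk s : inst s -> okcfg (cfgof s) ->
  improved (s 8) (run walk_prog s) \/
  run walk_prog s 24 0 = 0 /\
    exists N k, chain (cfgof s) N k /\ m * n + 2 < N.
Proof.
move=> ins okc; rewrite /walk_prog runS; set s1 := run _ s.
have f1 a : a != 24 -> s1 a = s a by move=> na; rewrite /s1 run_frame ?inE.
have ins1 : inst s1 by apply: inst_run ins.
have c1 : cfgof s1 = cfgof s by rewrite /cfgof !f1.
have [_ _ _ _ sB] := ins1.
have : walk_inv s (B * B) (run (LRep 46 (LRep 47 (LIf (V 24) LSkip step_prog))) s1).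
  rewrite -{1}sB; apply: (run_rep (I := fun i => walk_inv s (i * B))) => //; last 1 first.
  - move=> i s' iB ri fr inv'.
    rewrite mulSn addnC; apply: run_walk_inner => //.
    by apply: inst_frame ins1 => a aa; apply: fr; move: a aa; apply/allP.
  - by move=> i s2 s3; apply: walk_inv_indep.
  - right; split; first by rewrite /s1 runP update_same.
    by rewrite c1; apply: chain0.
case=> [imp|[d0 ch]]; [by left|right; split=> //].
by exists (B * B), (cfgof (run (LRep 46 (LRep 47 (LIf (V 24) LSkip step_prog))) s1)).
Qed.

Definition row_of (s : store) k h := s 9 (k * m + h).

Definition better S0 (s : store) := [/\ s 25 0 != 0, okcol (s 7) & Phi S0 < Phi (s 7)].

Definition stuck_at (T : nat -> nat) f x b a := exists T' N k,
  [/\ forall h, h < m -> T' h = T h, chain (T', f, x, b, a) N k & m * n + 2 < N].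

Definition ready x k b (s : store) :=
  [/\ inst s, s 27 0 = x, s 43 0 = k, s 28 0 = k * m & s 50 0 = b].

Definition entry_ok S0 x (T : nat -> nat) f b :=
  [/\ f < m /\ inc f x, T f = 0, okcol T /\ Phi S0 <= Phi T, b \in miss T (oth f x) &
      {subset miss S0 x <= miss T x}].

Lemma run_load s :
  cfgof (run load_prog s) = (s 8, s 11 (s 43 0), s 27 0, s 50 0, s 51 0).
Proof.
have -> : cfgof (run load_prog s) = (s 8, run load_prog s 20 0, run load_prog s 21 0,
    run load_prog s 22 0, run load_prog s 23 0) by rewrite /cfgof run_frame.
by rewrite /load_prog !runS !runP /= !updateE.
Qed.

Lemma run_attempt S0 x k b s : ready x k b s -> s 7 = S0 -> s 25 0 = 0 ->
  entry_ok S0 x (row_of s k) (s 11 k) b ->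
  better S0 (run attempt_prog s) \/
  [/\ run attempt_prog s 25 0 = 0, run attempt_prog s 7 = S0 &
      lo x <= s 45 0 < lo x.+1 -> (col (s 45 0)).+1 \in miss S0 x ->
      stuck_at (row_of s k) (s 11 k) x b (col (s 45 0)).+1].
Proof.
move=> [ins sx sk so sb] s7 p0 [[fm fx] Tf [okT PT] bM sub].
have [_ _ _ [e3 e4] sB] := ins.
rewrite /attempt_prog runI eval_EAnd eval_in_list eval_ENot [eval s (V 27)]/= [eval s (V 45)]/=
  [eval s (V 25)]/= p0 eqxx andbT sx e3.
case: ifP => rg; last by right.
rewrite runS; set s1 := run _ s.
have s1a : s1 51 0 = (col (s 45 0)).+1 by rewrite /s1 runP update_same /= e4 addn1.
have f1 a : a != 51 -> s1 a = s a by move=> na; rewrite /s1 run_frame ?inE.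
have ins1 : inst s1 by apply: inst_run ins.
rewrite runS; have := @run_find 7 (V 27) (V 51) s1 ins1 isT isT isT.
set s2 := run (find_prog _ _ _) s1.
rewrite [eval _ _]/= [eval _ (V 51)]/= (f1 27) // (f1 7) // sx s7 s1a.
have f2 a : a \notin [:: 31; 30; 31] ++ [:: 51] -> s2 a = s a.
  by rewrite mem_cat negb_or => /andP[n1]; rewrite inE => n2; rewrite /s2 run_frame ?f1.
case=> [[z0 nu]|[g [gm zg gx sg]]]; rewrite runI; last first.
  rewrite [eval _ _]/= zg /=; right; rewrite runK; split; rewrite ?f2 //.
  by move=> _ /missP[_ /(_ g gm gx)]; rewrite sg eqxx.
rewrite [eval _ _]/= z0 [0 != 0]/= runS.
have ins2 : inst s2 by apply: inst_frame ins => a aa; apply: f2; move: a aa; apply/allP.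
have c3 j : run (copy_prog 8 (Const 0) 9 (V 28)) s2 8 j = if j < m then row_of s k j else s2 8 j.
  rewrite (run_copy _ ins2) // [eval _ _]/= [eval _ (V 28)]/= !add0n subn0.
  by rewrite (f2 28) // (f2 9) // so.
set s3 := run (copy_prog _ _ _ _) s2 in c3 *.
have f3 a : a \notin [:: 34; 8] ++ [:: 31; 30; 31] ++ [:: 51] -> s3 a = s a.
  by rewrite mem_cat negb_or => /andP[n1 n2]; rewrite /s3 run_frame ?f2.
rewrite runS; set s4 := run load_prog s3.
have c4 : cfgof s4 = (s3 8, s 11 k, x, b, (col (s 45 0)).+1).
  have s51 : s3 51 0 = s1 51 0 by rewrite /s3 run_frame // /s2 run_frame.
  by rewrite /s4 run_load (f3 43) // (f3 11) // (f3 27) // (f3 50) // sk sx sb s51 s1a.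
have f4 a : a \notin [:: 20; 21; 22; 23] ++ [:: 34; 8] ++ [:: 31; 30; 31] ++ [:: 51] -> s4 a = s a.
  by rewrite mem_cat negb_or => /andP[n1 n2]; rewrite /s4 run_frame ?f3.
have ins4 : inst s4 by apply: inst_frame ins => a aa; apply: f4; move: a aa; apply/allP.
set T := row_of s k in Tf okT PT bM sub c3 *; set a := (col _).+1 in s1a nu c4 *.
have TE h : h < m -> T h = s3 8 h by move=> hm; rewrite c3 hm.
have aM : a \in miss S0 x.
  rewrite mem_filter nu /=; apply/mem_F; by exists (s 45 0).
have ok4 : okcfg (cfgof s4).
  rewrite c4; split=> //; first exact: eq_okcol okT.
    by rewrite -TE.
  by rewrite -!(eq_miss _ _ _ _ TE); split=> //; apply: sub.
have s48 : s4 8 = s3 8 by have := congr1 (fun k : cfg => k.1.1.1.1) c4.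
rewrite runS runI.
case: (run_walk ins4 ok4); set s5 := run walk_prog s4.
  move=> [d0 ok5 P5]; left; rewrite [eval _ _]/= d0 runS runP.
  have ins5 : inst s5 by apply: inst_run ins4.
  have c6 j : j < m -> s5 8 j = run (copy_prog 7 (Const 0) 8 (Const 0)) s5 7 j.
    by move=> jm; rewrite (run_copy _ ins5) // [eval _ _]/= !add0n subn0 jm.
  split; first by rewrite update_same.
    by rewrite update_frame //; apply: eq_okcol ok5.
  rewrite update_frame // -(eq_Phi _ _ _ c6); move: P5; rewrite s48 -(eq_Phi _ _ _ TE).
  exact: leq_ltn_trans.
move=> [d0 [N [k' [ch NN]]]]; right; rewrite [eval _ _]/= d0 [0 != 0]/= runK.
have f5 b' : b' \notin writes walk_prog -> s5 b' = s4 b' by move=> nb; rewrite /s5 run_frame.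
split; rewrite ?f5 ?f4 // => _ _.
by exists (s3 8), N, k'; split=> //; [move=> h /TE|rewrite -c4].
Qed.

Lemma attempt_done s : s 25 0 != 0 -> run attempt_prog s = s.
Proof.
by move=> d; rewrite /attempt_prog runI eval_EAnd eval_ENot [eval s (V 25)]/= (negbTE d) andbF runK.
Qed.

Lemma run_attempts S0 x k b s : ready x k b s -> s 7 = S0 -> s 25 0 = 0 ->
  entry_ok S0 x (row_of s k) (s 11 k) b -> x < n ->
  better S0 (run (LRep 45 attempt_prog) s) \/
  [/\ run (LRep 45 attempt_prog) s 25 0 = 0, run (LRep 45 attempt_prog) s 7 = S0 &
      forall a, a \in miss S0 x -> stuck_at (row_of s k) (s 11 k) x b a].
Proof.
move=> rd s7 p0 en xn; have [ins sx sk so sb] := rd; have [_ _ _ _ sB] := ins.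
pose I i (s' : store) := better S0 s' \/
  [/\ s' 25 0 = 0, s' 7 = S0 & forall j, j < i -> lo x <= j < lo x.+1 ->
      (col j).+1 \in miss S0 x -> stuck_at (row_of s k) (s 11 k) x b (col j).+1].
have : I (s 6 0) (run (LRep 45 attempt_prog) s).
  apply: run_rep => //.
  - by move=> i s1 s2 e; rewrite /I /better -!e.
  - by right.
  move=> i s' iB ri fr [bt|[p1 s71 st]].
    by left; rewrite attempt_done //; case: bt.
  have e9 : row_of s' k = row_of s k by rewrite /row_of fr.
  have e11 : s' 11 = s 11 by rewrite fr.
  have rd' : ready x k b s'.
    split; rewrite ?fr //; by apply: inst_frame ins => a aa; apply: fr; move: a aa; apply/allP.
  have en' : entry_ok S0 x (row_of s' k) (s' 11 k) b by rewrite e9 e11.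
  case: (run_attempt rd' s71 p1 en'); first by left.
  move=> [p2 s72 st']; right; split=> // j; rewrite ltnS leq_eqVlt => /orP[/eqP -> |]; last exact: st.
  by move: st'; rewrite e9 e11 ri.
rewrite /I sB; case; [by left|move=> [p1 s71 st]; right; split=> // a /[dup] aM].
rewrite mem_filter => /andP[_ /mem_F[i [il ie]]]; rewrite -ie; apply: st; rewrite ?ie //.
have := loB xn; lia.
Qed.

(** * Growing the fan and checking all its entries *)

Definition ext (s s' : store) := s 26 0 <= s' 26 0 /\ forall j, j < s 26 0 ->
  [/\ s' 10 j = s 10 j, s' 11 j = s 11 j & forall h, h < m -> row_of s' j h = row_of s j h].

(** The two parts are the facts [stuck] and [closed] about stuck fans, for a single entry and a
    single colour. *)
Definition checked S0 x (s : store) k b :=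
  (forall a, a \in miss S0 x -> stuck_at (row_of s k) (s 11 k) x b a) /\
  (forall g, g < m -> inc g x -> S0 g = b -> exists2 j, j < s 26 0 & s 10 j = oth g x).

Lemma ext_trans s1 s2 s3 : ext s1 s2 -> ext s2 s3 -> ext s1 s3.
Proof.
move=> [l12 e12] [l23 e23]; split=> [|j jl]; first exact: leq_trans l23.
have [z12 f12 r12] := e12 j jl; have [z23 f23 r23] := e23 j (leq_trans jl l12).
by split; rewrite ?z23 ?f23 // => h hm; rewrite r23 ?r12.
Qed.

Lemma ext_frame s s' : (forall a, a \in [:: 9; 10; 11; 26] -> s' a = s a) -> ext s s'.
Proof. by move=> e; rewrite /ext /row_of !e. Qed.

(** The fan only grows and its old entries stay fixed, so a check made early remains valid for the
    final fan. *)
Lemma checked_ext S0 x s s' k b : k < s 26 0 -> ext s s' -> checked S0 x s k b -> checked S0 x s' k b.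
Proof.
move=> kl [ll e] [st cl]; have [_ f r] := e k kl; split=> [a /st|g gm gx Sg].
  rewrite f => -[T [N [k' [TE ch NN]]]]; exists T, N, k'; split=> // h hm.
  by rewrite TE ?r.
have [j jl zj] := cl g gm gx Sg; exists j; first exact: leq_trans ll.
by have [-> _ _] := e j jl.
Qed.

Definition going S0 x e (s : store) :=
  [/\ inst s /\ s 27 0 = x, s 25 0 = 0 /\ s 7 = S0,
      [/\ s 29 0 = s 26 0 * m, 0 < s 26 0 & s 10 0 = oth e x],
      fan S0 x (s 26 0) (s 10) (s 11) (row_of s) &
      forall v, v < n -> (s 12 v != 0) <-> exists2 j, j < s 26 0 & s 10 j = v].

Lemma going_frame S0 x e s s' :
  (forall a, a \in [:: 0; 1; 2; 3; 4; 6; 9; 10; 11; 12; 26; 27; 29] -> s' a = s a) ->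
  s' 25 0 = 0 -> s' 7 = S0 ->
  going S0 x e s -> going S0 x e s'.
Proof.
move=> ee p0' s7' [[ins sx] [p0 s7] [o l z] fn mk].
split; rewrite ?(ee 27) ?(ee 29) ?(ee 26) ?(ee 10) //.
- by split=> //; apply: inst_frame ins => a aa; apply: ee; move: a aa; apply/allP.
- have -> : row_of s' = row_of s by apply/funext => k; rewrite /row_of ee.
  by rewrite (ee 11).
- by rewrite (ee 12).
Qed.

Lemma stuck_eq T T' f x b a : (forall h, h < m -> T' h = T h) ->
  stuck_at T f x b a -> stuck_at T' f x b a.
Proof.
by move=> TT [T1 [N [k' [TE ch NN]]]]; exists T1, N, k'; split=> // h hm; rewrite TE // TT.
Qed.

Section Fan.
Variables (S0 : nat -> nat) (x e : nat).
Hypothesis okS : okcol S0.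
Hypothesis em : e < m.
Hypothesis ex : inc e x.

Lemma fan_entry_ok s k b : going S0 x e s -> k < s 26 0 -> b \in miss (row_of s k) (s 10 k) ->
  entry_ok S0 x (row_of s k) (s 11 k) b.
Proof.
move=> [_ _ _ [fn _] _] kl; have [[fm fx zk rf] [ok P] _ us _] := fn k kl.
rewrite zk => bM; split=> // a /[dup] aM; rewrite !mem_filter => /andP[ua ->].
by rewrite us ?ua // (miss_neq0 (F := F) _ aM) //; apply: F0.
Qed.

Lemma run_add_row s k : inst s -> s 43 0 = k -> s 28 0 = k * m -> s 29 0 = s 26 0 * m ->
  k < s 26 0 -> let s' := run add_row_prog s in
  [/\ s' 26 0 = (s 26 0).+1, s' 29 0 = (s 26 0).+1 * m,
      [/\ s' 10 = upd (s 10) (s 26 0) (s 36 0), s' 11 = upd (s 11) (s 26 0) (s 35 0) &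
          s' 12 = upd (s 12) (s 36 0) 1],
      forall j, j < s 26 0 -> forall h, h < m -> row_of s' j h = row_of s j h &
      forall h, h < m -> row_of s' (s 26 0) h =
        upd (upd (row_of s k) (s 11 k) (s 50 0)) (s 35 0) 0 h].
Proof.
move=> ins sk so sl kl; have [_ sm _ _ _] := ins.
rewrite /add_row_prog runS; set s1 := run (copy_prog _ _ _ _) s.
have c1 j : j < m -> s1 8 j = row_of s k j.
  by move=> jm; rewrite /s1 (run_copy _ ins) // [eval _ _]/= [eval _ (V 28)]/= !add0n subn0 jm so.
have f1 a : a \notin [:: 34; 8] -> s1 a = s a by move=> na; rewrite /s1 run_frame.
rewrite runS runP; set s2 := update s1 _ _ _.
rewrite runS runP; set s3 := update s2 _ _ _.
have f3 a : a != 8 -> s3 a = s1 a by move=> na; rewrite /s3 update_frame // /s2 update_frame.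
have c3 j : j < m -> s3 8 j = upd (upd (row_of s k) (s 11 k) (s 50 0)) (s 35 0) 0 j.
  move=> jm; rewrite /s3 /s2 !update_upd /= /upd !updateE /= (f1 43) // (f1 11) // (f1 50) // (f1 35) //.
  by rewrite sk c1.
rewrite runS; have ins3 : inst s3 by apply: inst_frame ins => a aa; rewrite f3 ?f1 //; move: a aa; apply/allP.
set s4 := run (copy_prog _ _ _ _) s3.
have c4 j : s4 9 j = if s 26 0 * m <= j < s 26 0 * m + m then s3 8 (j - s 26 0 * m) else s 9 j.
  rewrite /s4 (run_copy _ ins3) // [eval _ _]/= [eval _ (Const 0)]/= (f3 29) // (f3 9) //.
  by rewrite (f1 29) // (f1 9) // sl add0n.
have f4 a : a \notin [:: 34; 9] ++ [:: 34; 8] ++ [:: 8] -> s4 a = s a.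
  rewrite mem_cat negb_or => /andP[n1]; rewrite mem_cat negb_or => /andP[n2]; rewrite inE => n3.
  by rewrite /s4 run_frame // f3 // f1.
rewrite !runS !runP.
split.
- by simpl_store; rewrite f4 // addn1.
- by simpl_store; rewrite !f4 // sl sm mulSn addnC.
- by split; apply/funext => j; simpl_store; rewrite !f4.
- move=> j jl h hm; rewrite /row_of; simpl_store; rewrite c4.
  by have -> : (s 26 0 * m <= j * m + h) = false by nia.
- move=> h hm; rewrite {1}/row_of; simpl_store; rewrite c4.
  by rewrite leq_addr ltn_add2l hm addKn c3.
Qed.

(** At most one edge at [x] has colour [b]. Its other end is either marked, hence in the fan
    already, or gets appended. *)
Lemma run_extend s k b : going S0 x e s -> s 43 0 = k -> s 28 0 = k * m -> s 50 0 = b ->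
  k < s 26 0 -> b \in miss (row_of s k) (s 10 k) ->
  [/\ going S0 x e (run extend_prog s), ext s (run extend_prog s) &
      forall g, g < m -> inc g x -> S0 g = b ->
        exists2 j, j < run extend_prog s 26 0 & run extend_prog s 10 j = oth g x].
Proof.
move=> gs sk so sb kl bM; have [[ins sx] [p0 s7] [sl l0 z0] fn mk] := gs.
rewrite /extend_prog runI [eval s (V 25)]/= p0 [0 != 0]/= runS.
have := @run_find 7 (V 27) (V 50) s ins isT isT isT.
set s1 := run (find_prog _ _ _) s; rewrite [eval _ _]/= [eval _ (V 50)]/= sx sb s7 => r1.
have f1 a : a \notin [:: 31; 30; 31] -> s1 a = s a by move=> na; rewrite /s1 run_frame.
have going_of s' : (forall a, a \notin [:: 35; 36] ++ [:: 31; 30; 31] -> s' a = s a) ->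
    going S0 x e s' /\ ext s s'.
  move=> fr; split; first by apply: going_frame gs; rewrite ?fr // => a aa; apply: fr; move: a aa; apply/allP.
  by apply: ext_frame => a aa; apply: fr; move: a aa; apply/allP.
case: r1 => [[z31 nu]|[g [gm zg gx sg]]]; rewrite runI.
  rewrite [eval _ _]/= z31 [0 != 0]/= runK; have [] := going_of s1.
    by move=> a; rewrite mem_cat negb_or => /andP[_]; apply: f1.
  by split=> // g gm gx sg; case/usedP: nu; exists g.
rewrite [eval _ _]/= zg [_ != 0]/= runS runP; set s2 := update s1 _ _ _.
rewrite runS runP; set s3 := update s2 _ _ _.
have f3 a : a \notin [:: 35; 36] ++ [:: 31; 30; 31] -> s3 a = s a.
  rewrite mem_cat negb_or => /andP[n1 n2].
  have [n35 n36] : a != 35 /\ a != 36 by move: n1; rewrite !inE negb_or => /andP[].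
  by rewrite /s3 update_frame // /s2 update_frame // f1.
have [_ _ [e1 e2] _ _] := ins.
have s35 : s3 35 0 = g by rewrite /s3 /s2; simpl_store; rewrite zg subn1.
have s36 : s3 36 0 = oth g x.
  by rewrite /s3 /s2; simpl_store; rewrite zg subn1 /= !f1 // e1 e2 sx.
have [g3 e3] := going_of s3 f3; have [[ins3 _] _ _ fn3 mk3] := g3.
have uniqg g' : g' < m -> inc g' x -> S0 g' = b -> g' = g.
  by move=> gm' gx' sg'; apply: (okS.1 g' g x); rewrite ?sg' ?sg // (miss_neq0 _ bM) //; apply: F0.
have wn : oth g x < n by apply: (inc_ltn E1n E2n gm); apply: inc_oth.
rewrite runI; have -> : eval s3 (Get 12 (V 36)) = s 12 (oth g x) by rewrite /= s36 f3.
case: ifP => mkw.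
  rewrite runK; split=> // g' gm' gx' sg'; rewrite (uniqg g') // !f3 //.
  exact: (mk _ wn).1.
have s43 : s3 43 0 = k by rewrite f3.
have s28 : s3 28 0 = k * m by rewrite f3.
have s29 : s3 29 0 = s3 26 0 * m by rewrite !f3.
have kl3 : k < s3 26 0 by rewrite f3.
have [] := run_add_row ins3 s43 s28 s29 kl3; set s4 := run add_row_prog s3.
have f4 a : a \notin writes add_row_prog -> s4 a = s3 a by move=> na; rewrite /s4 run_frame.
have rowE j h : row_of s3 j h = row_of s j h by rewrite /row_of f3.
rewrite s36 s35 (f3 26) // (f3 10) // (f3 11) // (f3 12) // (f3 50) // sb.
move=> j26 j29 [j10 j11 j12] rold rnew.
have new j : j < s 26 0 -> s 10 j != oth g x.
  move=> jl; apply/eqP => zj; move: mkw; rewrite (_ : s 12 _ != 0) //.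
  by apply/mk => //; exists j.
have fn4 : fan S0 x (s 26 0).+1 (s4 10) (s4 11) (row_of s4).
  apply: (fan_add E12 F0 okS fn kl bM gm gx sg new).
  - by move=> j jl; rewrite j10 j11 /upd (ltn_eqF jl).
  - by move=> j jl h hm; rewrite rold.
  - by rewrite j10 /upd eqxx.
  - by rewrite j11 /upd eqxx.
  - move=> h hm; rewrite rnew //; congr (upd (upd _ _ _) _ _ _).
    by apply/funext => h'; rewrite rowE.
have e4 : ext s s4.
  split=> [|j jl]; first by rewrite j26.
  by rewrite j10 j11 /upd (ltn_eqF jl); split=> // h hm; rewrite rold.
split=> //.
  split.
  - split; first by apply: inst_run ins3.
    by rewrite f4 // f3.
  - by rewrite !f4 // !f3.
  - by rewrite j29 j26 j10 /upd (ltn_eqF l0).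
  - by rewrite j26.
  - move=> v vn; rewrite j26 j12 /upd; case: (eqVneq v (oth g x)) => [->|nv].
      split=> // _; exists (s 26 0); rewrite ?ltnS // j10 /upd eqxx //.
    rewrite mk //; split=> -[j jl jz].
      by exists j; rewrite ?ltnS 1?ltnW // j10 /upd (ltn_eqF jl).
    move: jl jz; rewrite ltnS leq_eqVlt j10 /upd => /orP[/eqP -> |jl].
      by rewrite eqxx => wv; rewrite wv eqxx in nv.
    by rewrite (ltn_eqF jl) => jz; exists j.
move=> g' gm' gx' sg'; rewrite (uniqg g') //.
by exists (s 26 0); rewrite ?j26 // j10 /upd eqxx.
Qed.

Lemma color_done s : s 25 0 != 0 -> run color_prog s = s.
Proof.
by move=> d; rewrite /color_prog runI eval_EAnd eval_ENot [eval s (V 25)]/= (negbTE d) andbF runK.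
Qed.

Lemma run_color s k : going S0 x e s -> s 43 0 = k -> s 28 0 = k * m -> k < s 26 0 ->
  better S0 (run color_prog s) \/
  [/\ going S0 x e (run color_prog s), ext s (run color_prog s) &
      lo (s 10 k) <= s 44 0 < lo (s 10 k).+1 ->
      (col (s 44 0)).+1 \in miss (row_of s k) (s 10 k) ->
      checked S0 x (run color_prog s) k (col (s 44 0)).+1].
Proof.
move=> gs sk so kl; have [[ins sx] [p0 s7] [sl l0 z0] fn mk] := gs.
have [_ _ _ [e3 e4] _] := ins.
rewrite /color_prog runI eval_EAnd eval_in_list eval_ENot [eval s (Get _ _)]/= [eval s (V 44)]/=
  [eval s (V 25)]/= p0 eqxx andbT sk e3.
case: ifP => rg; last by right; rewrite runK.
set b := (col _).+1.
rewrite runS runP; set s1 := update s _ _ _.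
have f1 a : a != 50 -> s1 a = s a by move=> na; rewrite /s1 update_frame.
have s1b : s1 50 0 = b by rewrite /s1; simpl_store; rewrite e4 addn1.
have ins1 : inst s1 by apply: inst_frame ins => a aa; apply: f1; move: a aa; apply/allP.
rewrite runS; set s2 := run (copy_prog _ _ _ _) s1.
have f2 a : a \notin [:: 34; 8] ++ [:: 50] -> s2 a = s a.
  by rewrite mem_cat negb_or => /andP[n1]; rewrite inE => n2; rewrite /s2 run_frame ?f1.
have c2 j : j < m -> s2 8 j = row_of s k j.
  move=> jm; rewrite /s2 (run_copy _ ins1) // [eval _ _]/= [eval _ (V 28)]/= !add0n subn0 jm.
  by rewrite (f1 28) // (f1 9) // so.
have ins2 : inst s2 by apply: inst_frame ins => a aa; apply: f2; move: a aa; apply/allP.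
have s2b : s2 50 0 = b by rewrite /s2 run_frame.
rewrite runS; have := @run_find 8 (Get 10 (V 43)) (V 50) s2 ins2 isT isT isT.
set s3 := run (find_prog _ _ _) s2.
rewrite [eval _ _]/= [eval _ (V 50)]/= (f2 43) // (f2 10) // sk s2b (eq_used _ _ _ _ c2).
have f3 a : a \notin [:: 31; 30; 31] ++ [:: 34; 8] ++ [:: 50] -> s3 a = s a.
  by rewrite mem_cat negb_or => /andP[n1 n2]; rewrite /s3 run_frame ?f2.
have g3 : going S0 x e s3.
  by apply: going_frame gs; rewrite ?f3 // => a aa; apply: f3; move: a aa; apply/allP.
have e03 : ext s s3 by apply: ext_frame => a aa; apply: f3; move: a aa; apply/allP.
case=> [[z31 nu]|[g [gm zg gz sg]]]; rewrite runI; last first.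
  rewrite [eval _ _]/= zg [_ != 0]/= runK; right; split=> // _ /missP[_ /(_ g gm gz)].
  by rewrite -c2 // sg eqxx.
rewrite [eval _ _]/= z31 [0 != 0]/= runS.
have bM : b \in miss (row_of s k) (s 10 k).
  by rewrite mem_filter nu /=; apply/mem_F; exists (s 44 0).
have row3 j : row_of s3 j = row_of s j by apply/funext => h; rewrite /row_of f3.
have [[ins3 sx3] [p3 s73] _ _ _] := g3.
have s3b : s3 50 0 = b by rewrite /s3 run_frame.
have rd3 : ready x k b s3 by split; rewrite // f3.
have en3 : entry_ok S0 x (row_of s3 k) (s3 11 k) b.
  by rewrite row3 f3 //; apply: fan_entry_ok gs kl bM.
have xn : x < n := inc_ltn E1n E2n em ex.
have := run_attempts rd3 s73 p3 en3 xn.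
have : forall a, a \notin writes (LRep 45 attempt_prog) -> run (LRep 45 attempt_prog) s3 a = s3 a.
  by move=> a na; rewrite run_frame.
set s4 := run (LRep _ _) s3 => f4.
case=> [bt|[p4 s74 st]].
  by left; rewrite /extend_prog runI [eval _ _]/=; case: (bt) => -> _ _; rewrite runK.
have f4' a : a \in [:: 0; 1; 2; 3; 4; 6; 9; 10; 11; 12; 26; 27; 28; 29; 43] -> s4 a = s a.
  by move=> aa; rewrite f4 ?f3 //; move: a aa; apply/allP.
have g4 : going S0 x e s4.
  apply: going_frame gs => // a aa; apply: f4'; move: a aa; exact/allP.
have e04 : ext s s4 by apply: ext_frame => a aa; apply: f4'; move: a aa; apply/allP.
have row4 j : row_of s4 j = row_of s j by apply/funext => h; rewrite /row_of f4'.
have s4k : s4 43 0 = k by rewrite f4'.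
have s4o : s4 28 0 = k * m by rewrite f4'.
have s4b : s4 50 0 = b by rewrite f4.
have kl4 : k < s4 26 0 by rewrite f4'.
have bM4 : b \in miss (row_of s4 k) (s4 10 k) by rewrite row4 f4'.
have [g5 e45 cl] := run_extend g4 s4k s4o s4b kl4 bM4.
right; split=> //; first exact: ext_trans e04 e45.
move=> _ _; split=> // a aM; have [_ e45'] := e45.
have [|_ f5 r5] := e45' k; first by rewrite f4'.
rewrite f5 f4' // -(f3 11) //; apply: stuck_eq (st a aM) => h hm.
by rewrite r5 // row4 row3.
Qed.

Lemma going_indep r s1 s2 :
  r \notin [:: 0; 1; 2; 3; 4; 6; 7; 9; 10; 11; 12; 25; 26; 27; 29] ->
  (forall a, a != r -> s1 a = s2 a) -> going S0 x e s1 -> going S0 x e s2 /\ ext s1 s2.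
Proof.
move=> rn ee gs; have e' a : a \in [:: 0; 1; 2; 3; 4; 6; 7; 9; 10; 11; 12; 25; 26; 27; 29] ->
    s2 a = s1 a by move=> ain; rewrite ee //; apply: contraNneq rn => <-.
have [_ [p0 s7] _ _ _] := gs; split.
  apply: going_frame gs; rewrite ?e' // => a aa; apply: e'; move: a aa; exact/allP.
by apply: ext_frame => a aa; apply: e'; move: a aa; apply/allP.
Qed.

Lemma better_indep r s1 s2 : r \notin [:: 7; 25] ->
  (forall a, a != r -> s1 a = s2 a) -> better S0 s1 -> better S0 s2.
Proof.
move=> rn ee; have e' a : a \in [:: 7; 25] -> s2 a = s1 a.
  by move=> ain; rewrite ee //; apply: contraNneq rn => <-.
by rewrite /better !e'.
Qed.

Lemma going_z s k : going S0 x e s -> k < s 26 0 -> s 10 k < n.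
Proof.
move=> [_ _ _ [fn _] _] kl; have [[fm fx -> _] _ _ _ _] := fn k kl.
by apply: (inc_ltn E1n E2n fm); apply: inc_oth.
Qed.

Lemma ext_miss s s' k : ext s s' -> k < s 26 0 ->
  miss (row_of s' k) (s' 10 k) = miss (row_of s k) (s 10 k).
Proof. by move=> [_ ee] /ee[-> _ r]; apply: eq_miss. Qed.

Lemma run_colors s k : going S0 x e s -> s 43 0 = k -> s 28 0 = k * m -> k < s 26 0 ->
  better S0 (run (LRep 44 color_prog) s) \/
  [/\ going S0 x e (run (LRep 44 color_prog) s), ext s (run (LRep 44 color_prog) s) &
      forall b, b \in miss (row_of s k) (s 10 k) ->
        checked S0 x (run (LRep 44 color_prog) s) k b].
Proof.
move=> gs sk so kl; have [[ins sx] _ _ _ _] := gs; have [_ _ _ _ sB] := ins.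
pose I i (s' : store) := better S0 s' \/ [/\ going S0 x e s', ext s s' &
  forall j, j < i -> lo (s 10 k) <= j < lo (s 10 k).+1 ->
    (col j).+1 \in miss (row_of s k) (s 10 k) -> checked S0 x s' k (col j).+1].
have : I (s 6 0) (run (LRep 44 color_prog) s).
  apply: run_rep => //.
  - move=> i s1 s2 ee [bt|[g1 e1 c1]]; first by left; apply: (@better_indep 44) ee bt.
    have [g2 e12] := @going_indep 44 s1 s2 isT ee g1; right; split=> //; first exact: ext_trans e12.
    move=> j ji jr jM; apply: checked_ext e12 (c1 j ji jr jM).
    by apply: leq_trans kl e1.1.
  - by right.
  move=> i s' iB ri fr [bt|[g1 e1 c1]].
    by left; rewrite color_done //; case: bt.
  have s'k : s' 43 0 = k by rewrite fr.
  have s'o : s' 28 0 = k * m by rewrite fr.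
  have kl' : k < s' 26 0 := leq_trans kl e1.1.
  case: (run_color g1 s'k s'o kl'); first by left.
  move=> [g2 e2 c2]; right; split=> //; first exact: ext_trans e2.
  have [z1 _ _] := e1.2 k kl.
  move=> j; rewrite ltnS leq_eqVlt => /orP[/eqP -> |ji jr jM].
    by rewrite -(ext_miss e1 kl) -z1 -ri => jr jM; apply: c2.
  exact: checked_ext e2 (c1 j ji jr jM).
rewrite /I sB; case=> [bt|[g1 e1 c1]]; [by left|right; split=> // b /[dup] bM].
rewrite mem_filter => /andP[_ /mem_F[i [il ie]]]; rewrite -ie; apply: c1; rewrite ?ie //.
have := loB (going_z gs kl); lia.
Qed.

Lemma entry_done s : better S0 s -> better S0 (run entry_prog s).
Proof.
move=> bt; rewrite /entry_prog runS runI eval_EAnd eval_ENot [eval s (V 25)]/=.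
case: (bt) => /negbTE -> _ _; rewrite andbF runK runP.
by apply: (@better_indep 28) bt => // a na; rewrite update_frame.
Qed.

Lemma run_entry s i : going S0 x e s -> s 43 0 = i -> s 28 0 = i * m ->
  better S0 (run entry_prog s) \/
  [/\ going S0 x e (run entry_prog s), ext s (run entry_prog s),
      run entry_prog s 28 0 = i.+1 * m &
      (i < s 26 0 -> forall b, b \in miss (row_of s i) (s 10 i) ->
        checked S0 x (run entry_prog s) i b) /\
      (s 26 0 <= i -> run entry_prog s 26 0 = s 26 0)].
Proof.
move=> gs si so; have [[[_ sm _ _ _] _] [p0 _] _ _ _] := gs.
rewrite /entry_prog runS; set s1 := run (LIf _ _ _) s.
have f1 a : a \notin writes (LRep 44 color_prog) -> s1 a = s a.
  by move=> na; rewrite /s1 run_frame //= cats0.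
have key : better S0 s1 \/ [/\ going S0 x e s1, ext s s1,
    i < s 26 0 -> forall b, b \in miss (row_of s i) (s 10 i) -> checked S0 x s1 i b &
    s 26 0 <= i -> s1 26 0 = s 26 0].
  rewrite /s1 runI eval_EAnd eval_ELt eval_ENot [eval _ (V 43)]/= [eval _ (V 26)]/=
    [eval _ (V 25)]/= p0 eqxx andbT si.
  case: ifP => il; last by right; rewrite runK.
  case: (run_colors gs si so il) => [|[g2 e2 c2]]; first by left.
  by right; split=> //; rewrite leqNgt il.
have u a : a != 28 -> s1 a = run (28 <~ Add (V 28) num_edges) s1 a.
  by move=> na; rewrite runP update_frame.
case: key => [bt|[g1 e1 c1 l1]]; first by left; apply: (@better_indep 28) u bt.
have [g2 e2] := @going_indep 28 _ _ isT u g1; right; split=> //.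
  by rewrite runP; simpl_store; rewrite !f1 // so sm mulSn addnC.
Qed.

(** Hence the loop over the entries, which runs at least [n] times, also reaches those appended
    while it is running. *)
Lemma going_len s : going S0 x e s -> s 26 0 <= n.
Proof.
move=> gs; have [_ _ _ [_ zi] _] := gs.
rewrite -(size_iota 0 (s 26 0)) -(size_map (s 10)) -[leqRHS](size_iota 0 n).
apply: uniq_leq_size => [|v /mapP[k]].
  by rewrite map_inj_in_uniq ?iota_uniq // => i j; rewrite !mem_iota !add0n; apply: zi.
by rewrite !mem_iota !add0n => kl ->; apply: going_z gs kl.
Qed.

Lemma run_entries s : going S0 x e s -> s 28 0 = 0 ->
  better S0 (run (LRep 43 entry_prog) s) \/
  going S0 x e (run (LRep 43 entry_prog) s) /\
  forall k b, k < run (LRep 43 entry_prog) s 26 0 ->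
    b \in miss (row_of (run (LRep 43 entry_prog) s) k) (run (LRep 43 entry_prog) s 10 k) ->
    checked S0 x (run (LRep 43 entry_prog) s) k b.
Proof.
move=> gs so; have [[ins sx] _ _ _ _] := gs; have [_ _ _ _ sB] := ins.
pose I i (s' : store) := better S0 s' \/ [/\ going S0 x e s', s' 28 0 = i * m &
  forall k b, k < i -> k < s' 26 0 -> b \in miss (row_of s' k) (s' 10 k) -> checked S0 x s' k b].
have : I (s 6 0) (run (LRep 43 entry_prog) s).
  apply: run_rep => //.
  - move=> i s1 s2 ee [bt|[g1 o1 c1]]; first by left; apply: (@better_indep 43) ee bt.
    have [g2 e12] := @going_indep 43 s1 s2 isT ee g1; right.
    split=> [//||k b ki kl]; first by rewrite -ee.
    have kl1 : k < s1 26 0 by rewrite ee.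
    by rewrite (ext_miss e12 kl1) => bM; apply: checked_ext e12 (c1 k b ki kl1 bM).
  - by right.
  move=> i s' iB ri fr [bt|[g1 o1 c1]]; first by left; apply: entry_done.
  case: (run_entry g1 ri o1) => [|[g2 e2 o2 c2]]; [by left|right; split=> // k b].
  (* Round [i] appends only if entry [i] exists, so whatever it appends has a number above [i] and
     is not yet claimed to be checked. *)
  rewrite ltnS => ki kl2; have kl : k < s' 26 0.
    by case: (ltnP i (s' 26 0)) => il; [apply: leq_ltn_trans il|rewrite -c2.2].
  rewrite (ext_miss e2 kl) => bM.
  case: (ltngtP k i) ki => // [ki _|ki _]; first exact: checked_ext e2 (c1 k b ki kl bM).
  by rewrite ki in kl bM *; apply: c2.1.
rewrite /I sB; case=> [|[g1 o1 c1]]; [by left|right; split=> // k b kl].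
by move=> bM; apply: c1 => //; apply: leq_trans kl (leq_trans (going_len g1) nB).
Qed.

Hypothesis Se : S0 e = 0.

(** Without an improvement all entries and colours end up checked, which [fan_stuck] excludes. *)
Lemma run_fan s : rich n m E1 E2 F x e -> going S0 x e s -> s 28 0 = 0 ->
  better S0 (run (LRep 43 entry_prog) s).
Proof.
move=> rxe gs so; case: (run_entries gs so) => [//|[g1 ch]]; exfalso.
move: g1 ch; set s1 := run _ s => -[_ _ [_ l0 z0] fn _] ch.
apply: (fan_stuck E1n E2n E12 F0 Funiq okS em ex Se l0 z0 fn) rxe.
  by move=> k b a kl bM aM; apply: (ch k b kl bM).1.
by move=> k b g kl bM; apply: (ch k b kl bM).2.
Qed.

Lemma run_start i2 s : i2 \in [:: 1; 2] -> let s' := run (start_prog i2) s in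
  [/\ s' 10 0 = s i2 (s 41 0), s' 11 0 = s 41 0, s' 12 = upd (s 12) (s i2 (s 41 0)) 1 &
      [/\ s' 26 0 = 1, s' 28 0 = 0 & s' 29 0 = s 0 1]].
Proof.
by rewrite !inE => /orP[] /eqP -> /=; rewrite /start_prog !runS !runP; split;
  try split; try (apply/funext => j); simpl_store.
Qed.

Lemma run_init i1 i2 s : i1 \in [:: 1; 2] -> i2 \in [:: 1; 2] ->
  inst s -> s 25 0 = 0 -> s 7 = S0 -> s 41 0 = e ->
  s i1 e = x -> s i2 e = oth e x ->
  going S0 x e (run (init_prog i1 i2) s) /\ run (init_prog i1 i2) s 28 0 = 0.
Proof.
move=> i1P i2P ins p0 s7 se sx sy; have [_ sm _ _ sB] := ins.
rewrite /init_prog runS runP; set s1 := update s _ _ _.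
have f1 a : a != 27 -> s1 a = s a by move=> na; rewrite /s1 update_frame.
have s1x : s1 27 0 = x by rewrite /s1 update_same /= se.
rewrite runS; set s2 := run (LRep _ _) s1.
have f2 a : a \notin [:: 42; 12] ++ [:: 27] -> s2 a = s a.
  by rewrite mem_cat negb_or => /andP[n1]; rewrite inE => n2; rewrite /s2 run_frame ?f1.
have m2 j : j < B -> s2 12 j = 0.
  have s1B : s1 6 0 = B by rewrite f1.
  rewrite -s1B /s2; pose I i (s' : store) := forall j, j < i -> s' 12 j = 0.
  suff : I (s1 6 0) (run (LRep 42 (LPut 12 (V 42) (Const 0))) s1) by move/(_ j).
  apply: run_rep => //; first by move=> i s3 s4 ee II j' ji; rewrite -ee ?II.
  move=> i s' iB ri _ II j'; rewrite runP updateE /= ri ltnS leq_eqVlt.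
  by case: eqP => //= _; apply: II.
rewrite runS; have := run_start s2 i2P; set s3 := run (start_prog i2) s2.
have si2 : s2 i2 = s i2 by apply: f2; move: i2 i2P {sy s3}; apply/allP.
rewrite /= (f2 41) // si2 se sy (f2 0) // sm => -[z3 e3 m3 [l3 o3 n3]].
have f3 a : a \notin [:: 10; 11; 12; 26; 28; 29] ++ [:: 42; 12] ++ [:: 27] -> s3 a = s a.
  by rewrite mem_cat negb_or => /andP[n1 n2]; rewrite /s3 run_frame ?f2.
have ins3 : inst s3 by apply: inst_frame ins => a aa; apply: f3; move: a aa; apply/allP.
have s3x : s3 27 0 = x by rewrite /s3 run_frame // /s2 run_frame.
set s4 := run (copy_prog _ _ _ _) s3.
have f4 a : a \notin [:: 34; 9] -> s4 a = s3 a by move=> na; rewrite /s4 run_frame.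
have r4 h : h < m -> row_of s4 0 h = S0 h.
  move=> hm; rewrite /row_of /s4 (run_copy _ ins3) // [eval _ _]/= mul0n !add0n subn0 hm /=.
  by rewrite f3 // s7.
split; last by rewrite f4.
split.
- by split; [apply: inst_frame ins3 => a aa; apply: f4; move: a aa; apply/allP|rewrite f4].
- by rewrite !f4 // !f3.
- by rewrite !f4 // l3 mul1n.
- rewrite f4 // l3; apply: fan_init okS em ex Se _ _ r4; by rewrite f4.
move=> v vn; rewrite !f4 // l3 m3 /upd; case: (eqVneq v (oth e x)) => [->|nv].
  by split=> // _; exists 0.
rewrite m2 ?(leq_trans vn) // eqxx; split=> // -[[|//] _]; rewrite z3 => ev.
by rewrite ev eqxx in nv.
Qed.

End Fan.

(** * Sides, edges, rounds and the whole run *)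

Definition kept S0 (s : store) := s 25 0 = 0 /\ s 7 = S0.

(** The first conclusion serves an end that is not [rich]: a search from there may fail, but it
    leaves the colouring intact for the other end. *)
Lemma run_side S0 x e i1 i2 s : i1 \in [:: 1; 2] -> i2 \in [:: 1; 2] ->
  okcol S0 -> e < m -> inc e x -> S0 e = 0 ->
  inst s -> s 41 0 = e -> s i1 e = x -> s i2 e = oth e x ->
  better S0 s \/ kept S0 s ->
  (better S0 (run (side_prog i1 i2) s) \/ kept S0 (run (side_prog i1 i2) s)) /\
  (better S0 s \/ rich n m E1 E2 F x e -> better S0 (run (side_prog i1 i2) s)).
Proof.
move=> i1P i2P okS em ex Se ins se sx sy; rewrite /side_prog runI [eval _ _]/= => -[bt|[p0 s7]].
  by case: (bt) => -> _ _; rewrite runK; split; [left|].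
rewrite p0 [0 != 0]/= runS.
have [g1 o1] := run_init okS em ex Se i1P i2P ins p0 s7 se sx sy.
split.
  case: (run_entries okS em ex g1 o1) => [bt|[g2 _]]; [by left|right].
  by case: g2 => _ [p2 s72] _ _ _.
case=> [[]|rxe]; first by rewrite p0.
exact: (run_fan okS em ex Se rxe g1 o1).
Qed.

Hypothesis richE : forall e, e < m -> rich n m E1 E2 F (E1 e) e \/ rich n m E1 E2 F (E2 e) e.

Lemma run_edge S0 s : okcol S0 -> inst s -> kept S0 s ->
  if (s 41 0 < m) && (S0 (s 41 0) == 0) then better S0 (run edge_prog s)
  else run edge_prog s = s.
Proof.
move=> okS ins /[dup] kS [p0 s7]; have [_ sm [e1 e2] _ _] := ins.
rewrite /edge_prog runI eval_EAnd eval_ELt eval_EEq [eval _ (V 41)]/= [eval _ num_edges]/=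
  [eval _ (Get _ _)]/= [eval _ (Const 0)]/= sm s7.
case: ifP => [/[dup] c /andP[em /eqP Se]|c]; rewrite c; last by rewrite runK.
set e := s 41 0 in em Se *; rewrite runS.
have ex1 : inc e (E1 e) by rewrite /inc eqxx.
have ex2 : inc e (E2 e) by rewrite /inc eqxx orbT.
have o1 : E2 e = oth e (E1 e) by rewrite /oth addKn.
have o2 : E1 e = oth e (E2 e) by rewrite /oth addnK.
have [] := @run_side S0 (E1 e) e 1 2 s isT isT okS em ex1 Se ins erefl _ _ (or_intror kS).
- by rewrite e1.
- by rewrite e2.
set s1 := run (side_prog 1 2) s => bk1 bt1.
have ins1 : inst s1 by apply: inst_run ins.
have f1 a : a \notin writes (side_prog 1 2) -> s1 a = s a by move=> na; rewrite /s1 run_frame.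
have [|||_ bt2] := @run_side S0 (E2 e) e 2 1 s1 isT isT okS em ex2 Se ins1 _ _ _ bk1.
- by rewrite f1.
- by rewrite f1 // e2.
- by rewrite f1 // e1.
by apply: bt2; case: (richE em) => rx; [left; apply: bt1; right|right].
Qed.

Lemma edge_done S0 s : better S0 s -> better S0 (run edge_prog s).
Proof.
move=> bt; have d1 i1 i2 s' : better S0 s' -> run (side_prog i1 i2) s' = s'.
  by move=> [p _ _]; rewrite /side_prog runI [eval _ _]/= p runK.
rewrite /edge_prog runI; case: ifP => _; last by rewrite runK.
by rewrite runS !d1 // d1.
Qed.

Definition full (T : nat -> nat) := forall j, j < m -> T j != 0.

Lemma run_round s : inst s -> okcol (s 7) ->
  (full (s 7) /\ run round_prog s 7 = s 7) \/
  [/\ ~ full (s 7), okcol (run round_prog s 7) & Phi (s 7) < Phi (run round_prog s 7)].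
Proof.
move=> ins okS; rewrite /round_prog runS runP; set s1 := update s _ _ _.
have f1 a : a != 25 -> s1 a = s a by move=> na; rewrite /s1 update_frame.
have ins1 : inst s1 by apply: inst_frame ins => a aa; apply: f1; move: a aa; apply/allP.
have [_ _ _ _ sB] := ins1.
pose I i (s' : store) := ~ full (s 7) /\ better (s 7) s' \/
  kept (s 7) s' /\ forall j, j < i -> j < m -> s 7 j != 0.
have : I (s1 6 0) (run (LRep 41 edge_prog) s1).
  apply: run_rep => //.
  - by move=> i s2 s3 ee; rewrite /I /better /kept -!ee.
  - by right.
  move=> i s' iB ri fr [[nf bt]|[kp fl]]; first by left; split=> //; apply: edge_done.
  have ins' : inst s' by apply: inst_frame ins1 => a aa; apply: fr; move: a aa; apply/allP.
  have := run_edge okS ins' kp; rewrite ri; case: ifP => [/andP[im /eqP Si] bt|no ->].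
    by left; split=> // /(_ i im); rewrite Si eqxx.
  right; split=> // j; rewrite ltnS leq_eqVlt => /orP[/eqP -> im|]; last exact: fl.
  by move: no; rewrite im /= => ->.
rewrite /I sB; case=> [[nf [_ ok P]]|[[_ ->] fl]]; [by right|left].
by split=> // j jm; apply: fl => //; apply: leq_trans mB.
Qed.

Lemma run_main s : inst s -> (forall j, s 7 j = 0) -> exists T, [/\ okcol T, full T &
  forall j, j < m -> run main_prog s 5 j = (T j).-1].
Proof.
move=> ins s7; have [_ _ _ _ sB] := ins; rewrite /main_prog runS.
pose I i (s' : store) := okcol (s' 7) /\ (full (s' 7) \/ i <= Phi (s' 7)).
have : I (s 6 0) (run (LRep 40 round_prog) s).
  apply: run_rep => //.
  - by move=> i s1 s2 ee; rewrite /I -!ee.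
  - by split; [split=> [i j v _ _ _ _|i _]; rewrite s7|right].
  move=> i s' iB ri fr [ok fP].
  have ins' : inst s' by apply: inst_frame ins => a aa; apply: fr; move: a aa; apply/allP.
  case: (run_round ins' ok) => [[fl e7]|[nf ok1 P1]].
    by rewrite /I e7; split=> //; left.
  by split=> //; case: fP => [/nf //|iP]; right; apply: leq_ltn_trans P1.
rewrite /I sB; set s1 := run _ s => -[ok fP].
(* A round that starts from an incomplete colouring raises [Phi], so a colouring still incomplete
   after [B] rounds would have [Phi] at least [B], more than twice the number of edges. *)
have fl : full (s1 7).
  by case: fP => // BP; have := leq_trans BP (Phi_le m E1 E2 F _); rewrite leqNgt roundB.
exists (s1 7); split=> // j jm.
have [_ _ _ _ s1B] : inst s1 by apply: inst_run ins.
pose I' i (s' : store) := forall j, j < i -> s' 5 j = (s1 7 j).-1.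
suff : I' (s1 6 0) (run (LRep 48 (LPut 5 (V 48) (Defs.Sub (Get 7 (V 48)) (Const 1)))) s1).
  by move/(_ j); rewrite s1B => -> //; apply: leq_trans mB.
apply: run_rep => //; first by move=> i s2 s3 ee II j' ji; rewrite -ee ?II.
move=> i s' iB ri fr II j'; rewrite runP updateE /= ri ltnS leq_eqVlt.
rewrite (fr 7) // subn1; case: eqP => [-> //|_] /= ji; exact: II.
Qed.

End Correctness.

(** * From multigraphs to coded graphs *)

Lemma card_ge_seq A k : card_ge A k ->
  exists s, [/\ size s = k, uniq s & forall c, c \in s -> A c].
Proof.
move=> /pcard_leP[f]; exists (map f (iota 0 k)); split.
- by rewrite size_map size_iota.
- rewrite map_inj_in_uniq ?iota_uniq // => i j; rewrite !mem_iota !add0n /= => ik jk.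
  by apply: inj; rewrite inE.
by move=> c /mapP[i]; rewrite mem_iota add0n => /= ik ->; apply: funS.
Qed.

Lemma card_le_size A k s : card_le_nat A k -> uniq s -> (forall c, c \in s -> A c) -> size s <= k.
Proof.
move=> /pcard_leP[f] us sA; rewrite -(size_map f) -[leqRHS](size_iota 0 k).
apply: uniq_leq_size => [|c /mapP[i /sA iA ->]].
  by rewrite map_inj_in_uniq // => i j /sA iA /sA jA; apply: inj; rewrite inE.
by rewrite mem_iota add0n; exact: (@funS _ _ _ _ f i iA).
Qed.

Lemma sumn_take (sh : seq nat) i j : i <= j -> sumn (take i sh) <= sumn (take j sh).
Proof.
by move=> /subnKC <-; rewrite takeD sumn_cat leq_addr.
Qed.

(** This recovers a list from its segment of the concatenation; for [v] out of range both sides are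
    empty. *)
Lemma nth_flatten_block (T : Type) (x0 : T) (ss : seq (seq T)) v :
  [seq nth x0 (flatten ss) i | i <- iota (sumn (take v (map size ss)))
     (sumn (take v.+1 (map size ss)) - sumn (take v (map size ss)))] = nth [::] ss v.
Proof.
elim: ss v => [|s ss IH] [|v] //=.
  rewrite take0 /= addn0 subn0 -[RHS](mkseq_nth x0) /mkseq.
  by apply/eq_in_map => i; rewrite mem_iota add0n => /= il; rewrite nth_cat il.
rewrite subnDl -IH iotaDl -map_comp; apply: eq_map => i /=.
by rewrite nth_cat ltnNge leq_addr addKn.
Qed.

(** * Running the program on a multigraph *)

Section Solve.
Variables (G : multigraph) (F : vert G -> seq nat).

Let n := #|vert G|.
Let m := #|edge G|.
Let E1 := input F 1.
Let E2 := input F 2.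
Let lo := input F 3.
Let col := input F 4.

Lemma coded_ends (e : edge G) : exists a b, [/\ a != b, ends e = [set a; b]%SET,
  E1 (enum_rank e) = enum_rank a & E2 (enum_rank e) = enum_rank b].
Proof.
have : size (enum (ends e)) = 2 by rewrite -cardE endsP.
case en : (enum (ends e)) => [|a [|b [|c s]]] // _; exists a, b.
have un := enum_uniq (ends e); rewrite en /= inE andbT in un.
split=> //.
- by apply/setP => x; rewrite -mem_enum en !inE.
- rewrite /E1 /= (nth_map e) -?cardE ?ltn_ord // nth_enum_rank /endpoint_numbers en //.
- rewrite /E2 /= (nth_map e) -?cardE ?ltn_ord // nth_enum_rank /endpoint_numbers en //.
Qed.

Lemma coded_edge i : i < m -> exists e : edge G, i = enum_rank e.
Proof. by move=> im; exists (enum_val (Ordinal im)); rewrite enum_valK. Qed.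

Lemma coded_vert v : v < n -> exists x : vert G, v = enum_rank x.
Proof. by move=> vn; exists (enum_val (Ordinal vn)); rewrite enum_valK. Qed.

Lemma rank_eq (T : finType) (x y : T) : (enum_rank x == enum_rank y :> nat) = (x == y).
Proof. by rewrite val_eqE (inj_eq enum_rank_inj). Qed.

Lemma coded_inc (e : edge G) (x : vert G) : inc E1 E2 (enum_rank e) (enum_rank x) = (x \in ends e).
Proof.
have [a [b [_ -> e1 e2]]] := coded_ends e.
by rewrite /inc e1 e2 !rank_eq !inE ![x == _]eq_sym.
Qed.

Lemma coded_E1n i : i < m -> E1 i < n.
Proof. by case/coded_edge => e ->; have [a [b [_ _ -> _]]] := coded_ends e; apply: ltn_ord. Qed.

Lemma coded_E2n i : i < m -> E2 i < n.
Proof. by case/coded_edge => e ->; have [a [b [_ _ _ ->]]] := coded_ends e; apply: ltn_ord. Qed.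

Lemma coded_E12 i : i < m -> E1 i != E2 i.
Proof.
by case/coded_edge => e ->; have [a [b [ab _ -> ->]]] := coded_ends e; rewrite rank_eq.
Qed.

Lemma size_lists : size [seq F x | x <- enum (vert G)] = n.
Proof. by rewrite size_map -cardE. Qed.

Lemma color_listE v : color_list lo col v =
  map succn (nth [::] [seq F x | x <- enum (vert G)] v).
Proof.
by rewrite -(nth_flatten_block 0) -map_comp /color_list.
Qed.

Lemma coded_list (x : vert G) : color_list lo col (enum_rank x) = map succn (F x).
Proof. by rewrite color_listE (nth_map x) -?cardE ?ltn_ord // nth_enum_rank. Qed.

Lemma sum_edges (p : pred nat) (q : pred (edge G)) :
  (forall e, p (enum_rank e) = q e) -> \sum_(i < m) p i = #|[set e | q e]%SET|.
Proof.
move=> pq; rewrite cardsE -sum1_card [RHS]big_mkcond /=.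
rewrite (reindex enum_rank) /=; last by apply: onW_bij; apply: enum_rank_bij.
by apply: eq_bigr => e _; rewrite pq unfold_in; case: (q e).
Qed.

Lemma coded_deg (x : vert G) : cdeg m E1 E2 (enum_rank x) = deg x.
Proof.
apply: (@sum_edges (fun i => inc E1 E2 i (enum_rank x)) (fun e => x \in ends e)) => e.
exact: coded_inc.
Qed.

(** The vertices have to differ: at [x = w] the left side would be the degree, while [mu x x] is
    zero since there are no loops. *)
Lemma coded_mult (x w : vert G) : x != w -> mult m E1 E2 (enum_rank x) (enum_rank w) = mu x w.
Proof.
move=> xw; apply: (@sum_edges (fun i => inc E1 E2 i (enum_rank x) && inc E1 E2 i (enum_rank w))
  (fun e => ends e == [set x; w]%SET)) => e; rewrite !coded_inc.
have [a [b [ab -> _ _]]] := coded_ends e.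
rewrite !inE; apply/andP/eqP => [[xa wa]|ee]; last by have := set21 x w; have := set22 x w; rewrite -ee !inE.
apply/eqP; rewrite eq_sym eqEcard !cards2 ab xw andbT; apply/fintype.subsetP => y.
by rewrite !inE => /orP[] /eqP ->.
Qed.

(** A maximum over at most one vertex, which extends [maxmu] to all numbers. *)
Definition coded_maxmu v := \max_(x : vert G | enum_rank x == v :> nat) maxmu x.

Lemma coded_maxmuE (x : vert G) : coded_maxmu (enum_rank x) = maxmu x.
Proof. by rewrite /coded_maxmu (big_pred1 x) // => y; rewrite rank_eq. Qed.

Lemma coded_mult_le (x : vert G) w : enum_rank x != w :> nat ->
  mult m E1 E2 (enum_rank x) w <= coded_maxmu (enum_rank x).
Proof.
rewrite coded_maxmuE; case: (ltnP w n) => [/coded_vert[z ->]|nw _].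
  by rewrite rank_eq => xz; rewrite coded_mult //; apply: leq_bigmax.
rewrite /mult big1 // => i _; case iw : (inc _ _ i w); rewrite ?andbF //.
by have := inc_ltn coded_E1n coded_E2n (ltn_ord i) iw; rewrite ltnNge nw.
Qed.

Definition enough_colors :=
  [\/ forall x, deg x + (deg x)./2 <= size (F x),
      forall x, deg x + maxmu x <= size (F x) |
      bipartite G /\ forall x, deg x <= size (F x)].

(** In the Shannon case the end of smaller degree is chosen; in the other two either end would
    do. *)
Lemma coded_rich : enough_colors -> forall e, e < m ->
  rich n m E1 E2 (color_list lo col) (E1 e) e \/ rich n m E1 E2 (color_list lo col) (E2 e) e.
Proof.
have sz x : size (color_list lo col (enum_rank x)) = size (F x) by rewrite coded_list size_map.
move=> en e em; case: en => [H|H|[[side sP] H]].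
- have H' v : v < n -> cdeg m E1 E2 v + (cdeg m E1 E2 v)./2 <= size (color_list lo col v).
    by case/coded_vert => x ->; rewrite sz coded_deg.
  have o1 : oth E1 E2 e (E1 e) = E2 e by rewrite /oth addKn.
  have o2 : oth E1 E2 e (E2 e) = E1 e by rewrite /oth addnK.
  case/orP: (leq_total (cdeg m E1 E2 (E1 e)) (cdeg m E1 E2 (E2 e))) => le.
    by left; constructor 1; rewrite o1.
  by right; constructor 1; rewrite o2.
- left; constructor 2; exists coded_maxmu => v /coded_vert[x ->]; split=> [|w xw].
    by rewrite sz coded_deg coded_maxmuE.
  exact: coded_mult_le.
- left; constructor 3; split=> [v /coded_vert[x ->]|]; first by rewrite sz coded_deg.
  exists (fun v => [exists x, (enum_rank x == v :> nat) && side x]) => i /coded_edge[f ->].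
  have [a [b [ab fE -> ->]]] := coded_ends f.
  have sideE x : [exists y, (enum_rank y == enum_rank x :> nat) && side y] = side x.
    apply/existsP/idP => [[y]|sx]; last by exists x; rewrite eqxx.
    by rewrite rank_eq => /andP[/eqP ->].
  by rewrite !sideE; apply: (sP f) => //; rewrite fE !inE eqxx ?orbT.
Qed.

(** A single loop bound for all purposes: it covers vertices, edges and list positions, exceeds
    [m.*2], and its square exceeds [m * n + 2]. *)
Definition bound := n + m + m + lo n + 5.

Definition start := update (input F) 6 0 bound.

Hypothesis Funiq : forall x, uniq (F x).

Lemma solve : enough_colors -> let s := run main_prog start in
  (forall e e' : edge G, e != e' -> (exists x, x \in ends e /\ x \in ends e') ->
     output s e <> output s e') /\
  (forall e : edge G, exists2 x, x \in ends e & output s e \in F x).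
Proof.
move=> en.
have uF v : uniq (color_list lo col v).
  rewrite color_listE map_inj_uniq; last exact: succn_inj.
  case: (ltnP v n) => [/coded_vert[x ->]|nv]; last by rewrite nth_default ?size_lists.
  by rewrite (nth_map x) -?cardE ?ltn_ord // nth_enum_rank.
have ins : inst n m E1 E2 lo col bound start by split.
have [||||||T [[pT aT] fT outT]] :=
  run_main coded_E1n coded_E2n coded_E12 uF _ _ _ _ _ (coded_rich en) ins _.
- by move=> v vn; rewrite /bound; have := sumn_take [seq size (F x) | x <- enum (vert G)] vn;
    rewrite /lo /= -!map_comp; lia.
- by rewrite /bound; lia.
- by rewrite /bound; lia.
- by rewrite /bound; nia.
- by rewrite /bound; lia.
- by [].
have outE (e : edge G) : output (run main_prog start) e = (T (enum_rank e)).-1.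
  by rewrite /output outT //; apply: ltn_ord.
have T0 (e : edge G) : T (enum_rank e) != 0 by apply: fT; apply: ltn_ord.
split=> [e e' ee [x [xe xe']]|e].
  rewrite !outE => TT; case/eqP: ee; apply: enum_rank_inj; apply: val_inj => /=.
  apply: (pT _ _ (enum_rank x)); rewrite ?coded_inc //; try exact: ltn_ord.
  by rewrite -(prednK (_ : 0 < T (enum_rank e))) ?TT ?prednK // lt0n.
have [a [b [ab eE e1 e2]]] := coded_ends e.
have := aT _ (ltn_ord (enum_rank e)) (T0 e); rewrite e1 e2 !coded_list.
case/orP => /mapP[c cF TE]; rewrite outE TE; [exists a|exists b]; rewrite // eE !inE eqxx ?orbT //.
Qed.

End Solve.

(** * Existence of colourings *)

Lemma ends_common (G : multigraph) (L : list_assignment G) x (e : edge G) c :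
  x \in ends e -> common_colors L x c -> L e c.
Proof. by move=> xe; apply; rewrite /= /incident inE. Qed.

Lemma solve_proper (G : multigraph) (L : list_assignment G) (F : vert G -> seq nat) s :
  (forall x c, 0 < deg x -> c \in F x -> common_colors L x c) ->
  (forall e e' : edge G, e != e' -> (exists x, x \in ends e /\ x \in ends e') ->
     output s e <> output s e') ->
  (forall e : edge G, exists2 x, x \in ends e & output s e \in F x) ->
  proper_list_coloring L (@output G s).
Proof.
move=> FL pr mem; split=> // e; have [x xe cF] := mem e; apply: (ends_common xe).
by apply: FL cF; rewrite /deg card_gt0; apply/set0Pn; exists e; rewrite inE.
Qed.

(** The common colours may form an infinite set, for instance at an isolated vertex, so exactly
    [k x] of them are chosen at each [x] before the program is run. *)
Lemma colorable (G : multigraph) (L : list_assignment G) (k : vert G -> nat) :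
  (forall x, card_ge (common_colors L x) (k x)) ->
  (forall F : vert G -> seq nat, (forall x, k x = size (F x)) -> enough_colors F) ->
  exists phi : edge G -> nat, proper_list_coloring L phi.
Proof.
move=> kL en.
have [F FP] := choice (fun x => card_ge_seq (kL x)).
have uF x : uniq (F x) by case: (FP x).
have kF x : k x = size (F x) by case: (FP x).
have [pr mem] := solve uF (en F kF).
exists (@output G (run main_prog (start F))); apply: solve_proper pr mem => x c _.
by case: (FP x) => _ _; apply.
Qed.

(** * The running time in terms of maximum degree and order *)

Definition bound_prog :=
  Add (Add (Add (Add (Get 0 (Const 0)) (Get 0 (Const 1))) (Get 0 (Const 1)))
           (Get 3 (Get 0 (Const 0)))) (Const 5).

Definition coloring_prog := Seq (Put 6 (Const 0) bound_prog) (compile main_prog).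

Lemma exec_coloring (G : multigraph) (F : vert G -> seq nat) :
  exists2 t, exec coloring_prog (input F) t (run main_prog (start F)) &
    t <= 20 + duration main_prog (bound F).
Proof.
have [t et lt] := exec_compile (start F) wf_main.
(* Computing and storing the loop bound takes exactly 16 steps. *)
exists (16 + t); last by move: lt; rewrite /start update_same; lia.
have e1 : exec (Put 6 (Const 0) bound_prog) (input F) 16 (start F).
  exact: (exec_put (input F) 6 (Const 0) bound_prog).
exact: exec_seq e1 et.
Qed.

(** Each edge is incident to some vertex, so the degrees sum to at least the number of edges; this
    removes the number of edges from the time bound. *)
Lemma sum_card_incident (G : multigraph) : #|edge G| <= #|vert G| * maxdeg G.
Proof.
rewrite -sum_nat_const; apply: (@leq_trans (\sum_(x : vert G) deg x)); last first.
  by apply: leq_sum => x _; apply: leq_bigmax.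
rewrite /deg /incident (eq_bigr (fun x => \sum_(e : edge G) (x \in ends e))); last first.
  move=> x _; rewrite -sum1_card big_mkcond; apply: eq_bigr => e _; rewrite inE; by case: (_ \in _).
rewrite exchange_big -sum1_card; apply: leq_sum => e _ /=.
have /card_gt0P[x xe] : 0 < #|ends e| by rewrite endsP.
by rewrite (bigD1 x) //= xe.
Qed.

Lemma size_lists_le (G : multigraph) (L : list_assignment G) (F : vert G -> seq nat) b :
  (forall x, 0 < deg x -> card_le_nat (common_colors L x) b) ->
  lists_common_colors L F -> input F 3 #|vert G| <= #|vert G| * b.
Proof.
move=> Lb LF; rewrite /input take_oversize; last by rewrite size_map size_lists.
rewrite sumnE !big_map; apply: (@leq_trans (\sum_(x <- enum (vert G)) b)); last first.
  by rewrite big_const_seq count_predT iter_addn_0 -cardE mulnC.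
rewrite -enumT; apply: leq_sum => x _.
have := LF x; case: ifP => [_ -> //|/negbT d0 [uF FL]].
by apply: card_le_size (Lb x _) uF _; rewrite ?lt0n // => c /FL.
Qed.

(** The program is the same for all [p]; only the polynomial [q] depends on [p]. *)
Lemma poly_time (P : forall G : multigraph, list_assignment G -> Prop) :
  (forall G L F, P G L -> lists_common_colors L F -> enough_colors F) ->
  poly_time_colorable P.
Proof.
move=> en p; exists coloring_prog.
(* With [d] the maximum degree and [k] the order, [k * d] bounds the number of edges and
   [k * eval2 p d k] the total length of the lists. *)
have [q qE] : polybound (fun d k => 20 + duration main_prog (k + k * d + k * d + k * eval2 p d k + 5)).
  have pk := polybound_snd; have pd := polybound_fst.
  have pp : polybound (eval2 p) by exists p.
  apply: polyboundD; first exact: polybound_const.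
  apply: polybound_duration; apply: polyboundD; last exact: polybound_const.
  by do ![apply: polyboundD | apply: polyboundM].
exists q => G L F PL Lb LF.
have uF x : uniq (F x).
  by have := LF x; case: ifP => [_ -> //|_ []].
have [pr mem] := solve uF (en G L F PL LF).
have [t et lt] := exec_coloring F.
exists t, (run main_prog (start F)); split=> //.
  rewrite -qE; apply: leq_trans lt _; rewrite leq_add2l; apply: duration_mono.
  rewrite /bound /order leq_add2r; apply: leq_add; last exact: size_lists_le Lb LF.
  by rewrite -!addnA leq_add2l leq_add // sum_card_incident.
apply: solve_proper pr mem => x c d0 cF.
by have := LF x; rewrite eqn0Ngt d0 /= => -[_ /(_ c) []]; auto.
Qed.

Lemma size_common (G : multigraph) (L : list_assignment G) (F : vert G -> seq nat) x k :
  lists_common_colors L F -> card_ge (common_colors L x) k -> 0 < deg x -> k <= size (F x).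
Proof.
move=> /(_ x) LF /card_ge_seq[s [<- us sL]] d0; move: LF; rewrite eqn0Ngt d0 /= => -[uF FL].
by apply: uniq_leq_size => // c /sL /FL.
Qed.

(** An isolated vertex gets the empty list in the input, so the Vizing bound must vanish there. *)
Lemma maxmu_isolated (G : multigraph) (x : vert G) : deg x = 0 -> maxmu x = 0.
Proof.
move=> d0; apply/eqP; rewrite -leqn0; apply/bigmax_leqP => z _; rewrite leqn0 cards_eq0.
apply/eqP/setP => e; rewrite !inE; apply/eqP => ee.
have := card0_eq d0 e; rewrite inE ee !inE eqxx //.
Qed.

Theorem theorem1p1 :
  (forall (G : multigraph) (L : list_assignment G),
    [/\ (forall x : vert G,
           card_ge (common_colors L x) (deg x + (deg x)./2)) ->
        exists phi : edge G -> nat, proper_list_coloring L phi,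
        (forall x : vert G,
           card_ge (common_colors L x) (deg x + maxmu x)) ->
        exists phi : edge G -> nat, proper_list_coloring L phi &
        bipartite G ->
        (forall x : vert G, card_ge (common_colors L x) (deg x)) ->
        exists phi : edge G -> nat, proper_list_coloring L phi]) /\
  [/\ poly_time_colorable (@shannon_lists),
      poly_time_colorable (@vizing_lists) &
      poly_time_colorable (@konig_lists)].
Proof.
split=> [G L|]; split.
- by move=> H; apply: (colorable H) => F FE; constructor 1 => x; rewrite -FE.
- by move=> H; apply: (colorable H) => F FE; constructor 2 => x; rewrite -FE.
- by move=> bip H; apply: (colorable H) => F FE; constructor 3; split=> // x; rewrite -FE.
- apply: poly_time => G L F H LF; constructor 1 => x.
  by case: (posnP (deg x)) => [->|d0] //; apply: size_common LF (H x) d0.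
- apply: poly_time => G L F H LF; constructor 2 => x.
  case: (posnP (deg x)) => [dx|d0]; last exact: size_common LF (H x) d0.
  by rewrite dx maxmu_isolated.
- apply: poly_time => G L F [bip H] LF; constructor 3; split=> // x.
  by case: (posnP (deg x)) => [->|d0] //; apply: size_common LF (H x) d0.
Qed.
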